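(* Let $F$ be a simple graph and let $k\geq 1$ be an integer. Then there exists $\varepsilon>0$ with the following property. Let $K\geq 1$ and suppose that $G$ is a $K$-almost-regular graph on $n$ vertices with minimum degree $\delta=\omega(n^{\frac{1}{2k}-\varepsilon})$ (that is, $\delta=\delta(n)$ satisfies $\delta(n)/n^{\frac{1}{2k}-\varepsilon}\to\infty$ as $n\to\infty$). Then, for $n$ sufficiently large, $G$ contains a copy of $F^{2k-1}$.
   Context: A graph $G$ is $K$-almost-regular if $\max_{v\in V(G)} d(v)\leq K\min_{v\in V(G)} d(v)$, where $d(v)$ is the degree of $v$. For a graph $F$, $F^{2k-1}$ denotes the graph obtained by replacing the edges of $F$ with pairwise internally vertex-disjoint paths of length $2k$. Asymptotic notation refers to $n\to\infty$ with $F,k,K$ fixed. *)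

(* Defs.v *)
From HB Require Import structures.
From mathcomp Require Import all_boot all_order all_algebra.
From mathcomp Require Import all_classical all_reals all_analysis.

Set Implicit Arguments.
Unset Strict Implicit.
Unset Printing Implicit Defensive.

Import Order.TTheory GRing.Theory Num.Theory.
Import numFieldNormedType.Exports.

Local Open Scope ring_scope.

Record sgraph := SGraph {
  vertex :> finType;
  adj : rel vertex;
  adj_sym : symmetric adj;
  adj_irrefl : irreflexive adj }.

Definition deg (G : sgraph) (v : G) : nat := #|[set w | adj v w]|.

(* Degrees are < #|G|, so the default value #|G| never affects the minimum
   when G has a vertex; on the graph without vertices min_deg is 0. *)
Definition min_deg (G : sgraph) : nat := \big[minn/#|G|]_(v : G) deg v.

Definition max_deg (G : sgraph) : nat := (\max_(v : G) deg v)%N.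

Definition almost_regular (R : realType) (K : R) (G : sgraph) : Prop :=
  (max_deg G)%:R <= K * (min_deg G)%:R.

(* Not necessarily induced. *)
Definition contains_copy (H G : sgraph) : Prop :=
  exists f : H -> G, injective f /\ forall x y, adj x y -> adj (f x) (f y).

(* Each unordered edge of F appears once, oriented along the enumeration of the
   vertices. *)
Definition edge (F : sgraph) : finType :=
  {p : F * F | adj p.1 p.2 && (enum_rank p.1 < enum_rank p.2)%N}.

Section Subdivision.
Variables (F : sgraph) (m : nat).

Definition sub_vertex : finType := (F + edge F * 'I_m)%type.

(* The i-th vertex, for 0 <= i <= m.+1, of the path of length m.+1 that
   replaces the edge e. *)
Definition path_vertex (e : edge F) (i : nat) : sub_vertex :=
  if i is j.+1 then
    if insub j is Some j' then inr (e, j') else inl (val e).2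
  else inl (val e).1.

Definition sub_adj : rel sub_vertex := fun a b =>
  [exists e : edge F, exists i : 'I_m.+1,
     ((a == path_vertex e i) && (b == path_vertex e i.+1)) ||
     ((b == path_vertex e i) && (a == path_vertex e i.+1))].

Lemma sub_adj_sym : symmetric sub_adj.
Proof.
by move=> a b; apply: eq_existsb => e; apply: eq_existsb => i; rewrite orbC.
Qed.

Lemma path_vertex_neq (e : edge F) (i : 'I_m.+1) :
  path_vertex e i != path_vertex e i.+1.
Proof.
case: i => [[|i] /= lt_im].
  case: insubP => //= _; apply/eqP => -[e12].
  by case/andP: (valP e); rewrite e12 adj_irrefl.
rewrite ltnS in lt_im; rewrite insubT /=.
case: insubP => //= u _ vu; apply/eqP => -[/(congr1 val)/=].
by rewrite vu => /n_Sn.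
Qed.

Lemma sub_adj_irrefl : irreflexive sub_adj.
Proof.
move=> a; apply/existsP => -[e /existsP[i]]; rewrite orbb.
by case/andP=> /eqP-> ; apply/negP; exact: path_vertex_neq.
Qed.

(* F^m in the notation of the literature: m new vertices on every edge. *)
Definition subdivision : sgraph := SGraph sub_adj_sym sub_adj_irrefl.

End Subdivision.

(* Main.v *)
(* Write D(x, y) for the number of walks of length 2k from x to y, and compare
   the number T of closed walks of length 4k, i.e. the sum of D^2, with n d^(2k).
   Call a pair linked when its 2k-paths cannot all be hit by boundedly many
   inner vertices.  A non-linked pair forces a positive proportion of its pairs
   of 2k-walks to form a closed walk with a repeated vertex, and by
   log-convexity of closed walk counts the degenerate closed 4k-walks number at
   most a constant times d times the closed (4k-2)-walks.  On the other hand D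
   is a Gram matrix, so Turan's theorem shows that without a linked clique of
   size |F| the non-linked pairs carry a positive proportion of T.  So either
   there is a linked clique, in which the subdivision is embedded greedily, or
   T is at most d times a constant times the number of closed (4k-2)-walks,
   hence T = O(n d^(2k)).
   In the second case 2k-walks from a vertex reach almost all vertices: as
   d^(2k) is nearly n, by Cauchy-Schwarz every vertex set of size n^(1-o(1))
   spans n^(2-o(1)) pairs joined by 2k-walks, and only few pairs are
   "crowded".  The branch vertices are then picked one by one inside the common
   neighbourhood of the previous ones, avoiding the few vertices for which the
   2k-walks to different branch vertices could meet. *)
Require Import Defs.
From HB Require Import structures.
From mathcomp Require Import all_boot all_order all_algebra.
From mathcomp Require Import all_classical all_reals all_analysis.
From mathcomp Require Import zify ring.

Set Implicit Arguments.
Unset Strict Implicit.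
Unset Printing Implicit Defensive.

Import Order.TTheory GRing.Theory Num.Theory.
Import numFieldNormedType.Exports.

(** * Cauchy-Schwarz and log-convex sequences over the naturals *)

Section NatSums.
Local Open Scope nat_scope.

Lemma sum_cauchy_schwarz (I : finType) (P : pred I) (f g : I -> nat) :
  (\sum_(i | P i) f i * g i) ^ 2
    <= (\sum_(i | P i) f i ^ 2) * (\sum_(i | P i) g i ^ 2).
Proof.
rewrite -(leq_pmul2l (isT : 0 < 2)) -mulnn !big_distrlr /=.
have -> : 2 * (\sum_(i | P i) \sum_(j | P j) f i ^ 2 * g j ^ 2) =
   \sum_(i | P i) \sum_(j | P j) (f i ^ 2 * g j ^ 2 + f j ^ 2 * g i ^ 2).
  under [RHS]eq_bigr do rewrite big_split /=.
  rewrite big_split /= [X in _ = _ + X]exchange_big /=.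
  by rewrite mul2n -addnn.
rewrite big_distrr /=.
apply: leq_sum => i _; rewrite big_distrr /=; apply: leq_sum => j _.
have := nat_Cauchy (f i * g j) (f j * g i).
by rewrite !expnMn mulnACA (mulnC (g j)) mulnACA => -[h _].
Qed.

Lemma sum_sqr_le (I : finType) (P : pred I) (f : I -> nat) :
  (\sum_(i | P i) f i) ^ 2 <= #|P| * \sum_(i | P i) f i ^ 2.
Proof.
have := sum_cauchy_schwarz P (fun=> 1) f.
by rewrite sum_nat_const muln1; under eq_bigr do rewrite mul1n.
Qed.

(** The ratio [b i.+1 / b i] is nondecreasing in [i]; division is avoided by cross-multiplying. *)
Lemma log_convex_shift (b : nat -> nat) (i j : nat) :
    (forall i, 0 < b i) -> (forall i, b i.+1 ^ 2 <= b i * b i.+2) ->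
  i <= j -> b i.+1 * b j <= b i * b j.+1.
Proof.
move=> b0 bc /subnK <-; elim: (j - i) => [|l IH]; first by rewrite add0n mulnC.
have := bc (l + i); rewrite !addSn => h; move: IH (b0 (l + i)) (b0 (l + i).+1) h.
move: (b (l + i)) (b (l + i).+1) (b (l + i).+2) => u v w h' u0 v0 h.
rewrite -(leq_pmul2r u0) -(leq_pmul2r v0).
have -> : b i.+1 * v * u * v = b i.+1 * u * v ^ 2 by ring.
have -> : b i * w * u * v = b i * v * (u * w) by ring.
exact: leq_mul.
Qed.

(** Moving one unit at a time from the smaller index to the larger never decreases the product; this
    stops when the smaller index is 1. *)
Lemma log_convex_extreme (b : nat -> nat) (i j : nat) :
    (forall i, 0 < b i) -> (forall i, b i.+1 ^ 2 <= b i * b i.+2) ->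
  0 < i -> 0 < j -> b i * b j <= b 1 * b (i + j).-1.
Proof.
move=> b0 bc; wlog ij : i j / i <= j.
  move=> H i0 j0; case: (leqP i j) => [ij|/ltnW ji]; first exact: H.
  by rewrite mulnC addnC; apply: H.
elim: i j ij => // -[_ j _ _ _|i IH j ij _ j0]; first by rewrite add1n.
apply: leq_trans (log_convex_shift b0 bc (ltnW ij)) _.
apply: leq_trans (IH j.+1 _ _ _) _ => //; first by lia.
by rewrite addnS.
Qed.

End NatSums.

(** * A weighted form of Turan's theorem *)

Section WeightedTuran.
Local Open Scope nat_scope.
Variables (V : finType) (L : rel V).

(** If the bound failed, induction inside the neighbourhood of each vertex of positive weight would
    give that neighbourhood at most half of the total weight. Non-adjacent pairs would then carry at
    least half of the squared weight. *)
Lemma weighted_turan (t : nat) (g : V -> nat) :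
    (forall s, size s = t -> pairwise L s -> all (fun x => 0 < g x) s -> False) ->
  (\sum_x g x) ^ 2 <= 4 ^ t * \sum_x \sum_(y | ~~ L x y) g x * g y.
Proof.
elim: t g => [|t IH] g noK; first by case: (noK [::]).
set N := \sum_x \sum_(y | _) _; set G := \sum_x g x.
have nbr x : 0 < g x -> (\sum_(y | L x y) g y) ^ 2 <= 4 ^ t * N.
  (* Cutting the weight down to the neighbourhood of [x] keeps the vertex type fixed; positivity of
     the weight records membership. *)
  move=> gx; pose h y := if L x y then g y else 0.
  have -> : \sum_(y | L x y) g y = \sum_y h y by rewrite big_mkcond.
  apply: leq_trans (IH h _) _.
    move=> s ss ps hs; apply: (noK (x :: s)); first by rewrite /= ss.
      rewrite /= ps andbT; apply: sub_all hs => y; rewrite /h.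
      by case: (L x y).
    by rewrite /= gx /=; apply: sub_all hs => y; rewrite /h; case: (L x y).
  rewrite leq_mul2l; apply/orP; right.
  by rewrite /N; apply: leq_sum => u _; apply: leq_sum => v _; apply: leq_mul; rewrite /h; case: ifP.
case: leqP => // lt_NG.
have half x : g x * (\sum_(y | L x y) g y) * 2 <= g x * G.
  case: (posnP (g x)) => [->|gx] //.
  rewrite -mulnA leq_mul2l; apply/orP; right.
  rewrite -leq_sqr expnMn; apply: leq_trans (ltnW lt_NG).
  by rewrite (expnSr 4 t) -mulnA (mulnC 4) mulnA; apply: leq_mul (nbr x gx) _.
have GE : G ^ 2 = N + \sum_x g x * \sum_(y | L x y) g y.
  rewrite -mulnn {1}/G big_distrl -big_split /=; apply: eq_bigr => x _.
  rewrite /G (bigID (L x)) /= mulnDr addnC; congr (_ + _).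
  by rewrite big_distrr.
have G2 : (\sum_x g x * \sum_(y | L x y) g y) * 2 <= G ^ 2.
  by rewrite big_distrl -mulnn {1}/G big_distrl; apply: leq_sum => x _.
have : 4 * N <= 4 ^ t.+1 * N.
  by rewrite expnS -mulnA leq_mul2l /= leq_pmull // expn_gt0.
by lia.
Qed.

End WeightedTuran.

(** * Walk counts and their bounds by degrees *)

Section Walks.
Local Open Scope nat_scope.
Variables (V : finType) (e : rel V).
Hypothesis e_sym : symmetric e.

Fixpoint nwalks (j : nat) (x y : V) : nat :=
  if j is j'.+1 then \sum_z e x z * nwalks j' z y else x == y.

Lemma nwalksD i j x y :
  nwalks (i + j) x y = \sum_z nwalks i x z * nwalks j z y.
Proof.
elim: i x => [|i IH] x /=.
  rewrite (bigD1 x) //= eqxx mul1n big1 ?addn0 // => z zx.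
  by rewrite eq_sym (negbTE zx).
under eq_bigr do rewrite IH big_distrr /=.
rewrite exchange_big /=; apply: eq_bigr => z _.
by rewrite big_distrl /=; apply: eq_bigr => w _; rewrite mulnA.
Qed.

Lemma nwalks0 x y : nwalks 0 x y = (x == y).
Proof. by []. Qed.

Lemma nwalks1 x y : nwalks 1 x y = e x y.
Proof.
rewrite /= (bigD1 y) //= eqxx muln1 big1 ?addn0 // => z zy.
by rewrite (negbTE zy) muln0.
Qed.

Lemma nwalksC j x y : nwalks j x y = nwalks j y x.
Proof.
elim: j x y => [|j IH] x y; first by rewrite /= eq_sym.
rewrite -[in RHS]addn1 nwalksD [LHS]/=; apply: eq_bigr => z _.
by rewrite IH nwalks1 e_sym mulnC.
Qed.

Variable D : nat.
Hypothesis degD : forall x, \sum_y e x y <= D.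

Lemma sum_nwalks_le j x : \sum_y nwalks j x y <= D ^ j.
Proof.
elim: j x => [|j IH] x.
  by rewrite /= (bigD1 x) //= eqxx big1 // => y; rewrite eq_sym => /negbTE->.
rewrite exchange_big /= expnS.
apply: leq_trans (leq_mul (degD x) (leqnn _)); rewrite big_distrl /=.
by apply: leq_sum => z _; rewrite -big_distrr /= leq_mul2l IH orbT.
Qed.

Lemma sum_sum_nwalks_le j : \sum_x \sum_y nwalks j x y <= #|V| * D ^ j.
Proof.
apply: (@leq_trans (\sum_(x : V) D ^ j)); last by rewrite sum_nat_const.
by apply: leq_sum => x _; apply: sum_nwalks_le.
Qed.

(** The end of the last edge is prescribed, so only [j] steps are free. The saved factor [D] later
    makes walks with a repeated vertex rare. *)
Lemma nwalksS_le j x y : nwalks j.+1 x y <= D ^ j.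
Proof.
rewrite -addn1 nwalksD; apply: leq_trans (sum_nwalks_le j x).
by apply: leq_sum => z _; rewrite nwalks1; case: (e z y); rewrite ?muln1 ?muln0.
Qed.

Variable d : nat.
Hypothesis degd : forall x, d <= \sum_y e x y.

Lemma sum_nwalks_ge j x : d ^ j <= \sum_y nwalks j x y.
Proof.
elim: j x => [|j IH] x.
  by rewrite /= (bigD1 x) //= eqxx.
rewrite exchange_big /= expnS.
apply: leq_trans (leq_mul (degd x) (leqnn _)) _; rewrite big_distrl /=.
by apply: leq_sum => z _; rewrite -big_distrr /= leq_mul2l IH orbT.
Qed.

Lemma sum_sum_nwalks_ge j : #|V| * d ^ j <= \sum_x \sum_y nwalks j x y.
Proof.
rewrite -sum_nat_const.
by apply: leq_sum => x _; apply: sum_nwalks_ge.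
Qed.

End Walks.

(** * Log-convexity of closed walk counts *)

Section ClosedWalks.
Local Open Scope nat_scope.
Variables (V : finType) (e : rel V).
Hypotheses (e_sym : symmetric e) (e_irr : irreflexive e).
Variable D : nat.
Hypothesis degD : forall x, \sum_y e x y <= D.
Hypothesis deg_gt0 : forall x, 0 < \sum_y e x y.

Local Notation wk := (nwalks e).
Local Notation c j z := (nwalks e j z z).

Lemma closed_even j z : c (j + j) z = \sum_y wk j z y ^ 2.
Proof.
by rewrite nwalksD; apply: eq_bigr => y _; rewrite -mulnn (nwalksC e_sym j y).
Qed.

Lemma closed_cauchy i j z : c (i + j) z ^ 2 <= c (i + i) z * c (j + j) z.
Proof.
rewrite !closed_even nwalksD; under eq_bigr do rewrite (nwalksC e_sym j).
exact: sum_cauchy_schwarz.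
Qed.

(** Indexed by half the length: the trace of the [2j]-th power of the adjacency matrix. *)
Definition num_closed (j : nat) : nat := \sum_z c (j + j) z.

Lemma closed_log_convex i z :
  c (i.+1 + i.+1) z ^ 2 <= c (i + i) z * c (i.+2 + i.+2) z.
Proof. by have := closed_cauchy i i.+2 z; rewrite addnS addSnnS. Qed.

Lemma closed2 z : c 2 z = \sum_y e z y.
Proof.
by rewrite (@closed_even 1); apply: eq_bigr => y _; rewrite nwalks1; case: e.
Qed.

Lemma closed_even_gt0 i z : 0 < c (i + i) z.
Proof.
elim/ltn_ind: i => -[_|[_|i IH]].
- by rewrite /= eqxx.
- by rewrite closed2.
have := closed_log_convex i z.
by case: (c (i.+2 + i.+2) z) => //; rewrite muln0 leqn0 expn_eq0 andbT eqn0Ngt IH.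
Qed.

(** A closed walk of length [2i + 2] is cut unevenly, as [i] plus [i + 2]; Cauchy-Schwarz over the
    pairs of cut points separates the two lengths. *)
Lemma num_closed_log_convex i :
  num_closed i.+1 ^ 2 <= num_closed i * num_closed i.+2.
Proof.
have E j : num_closed (j + j) = \sum_z \sum_y wk (j + j) z y ^ 2.
  by apply: eq_bigr => z _; rewrite closed_even.
have F j k : \sum_z c (j + k) z = \sum_(p : V * V) wk j p.1 p.2 * wk k p.1 p.2.
  rewrite -(pair_bigA _ (fun z y => wk j z y * wk k z y)) /=.
  apply: eq_bigr => z _; rewrite nwalksD.
  by apply: eq_bigr => y _; rewrite (nwalksC e_sym k y).
have -> : num_closed i.+1 = \sum_z c (i + i.+2) z by rewrite addnS -addSn.
rewrite F; apply: leq_trans (sum_cauchy_schwarz _ _ _) _.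
by rewrite /num_closed !F.
Qed.

Lemma num_closed0 : num_closed 0 = #|V|.
Proof.
rewrite /num_closed; under eq_bigr do rewrite /= eqxx.
by rewrite sum1_card.
Qed.

Lemma num_closed_gt0 i : 0 < #|V| -> 0 < num_closed i.
Proof.
move=> /card_gt0P[x _]; rewrite /num_closed (bigD1 x) //= ltn_addr //.
exact: closed_even_gt0.
Qed.

(* By log-convexity of the closed walk counts at a vertex, the extreme split
   2 + (2q - 2) maximises the product. *)
Lemma closed_prod_le q j z : 1 < q -> 0 < j < q + q ->
  c j z * c (q + q - j) z <= D * c (q.-1 + q.-1) z.
Proof.
move=> q1 /andP[j0 jq].
have [j1|j1] := eqVneq j 1.
  by rewrite j1 nwalks1 e_irr.
have [j2|j2] := eqVneq (q + q - j) 1.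
  by rewrite j2 mulnC nwalks1 e_irr.
have lc i k := @log_convex_extreme (fun i => c (i + i) z) i k
  (fun i => closed_even_gt0 i z) (fun i => closed_log_convex i z).
rewrite -leq_sqr expnMn.
(* For odd [j] the factors are not even closed walk counts. After squaring, each is split into its
   two halves, and the four even counts are regrouped into pairs of total half-length [q]. Excluding
   length 1 above keeps every half positive. *)
pose i := j./2; pose i' := uphalf j.
have ji : j = i + i' by rewrite /i /i'; lia.
have qi : q + q - j = (q - i') + (q - i) by lia.
rewrite {1}ji qi; apply: leq_trans (leq_mul (closed_cauchy _ _ _) (closed_cauchy _ _ _)) _.
have E a b a' b' : a * b * (a' * b') = (a * b') * (b * a') by ring.
rewrite E.
have le1 k : 0 < k < q -> c (k + k) z * c ((q - k) + (q - k)) z <= D * c (q.-1 + q.-1) z.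
  move=> /andP[k0 kq]; apply: leq_trans (lc k (q - k) k0 _) _; first by lia.
  by rewrite subnKC ?(ltnW kq) // closed2 leq_mul2r degD orbT.
by rewrite -mulnn; apply: leq_mul; apply: le1; rewrite /i /i'; lia.
Qed.

Lemma sum_closed_prod_le q j : 1 < q -> 0 < j < q + q ->
  \sum_z c j z * c (q + q - j) z <= D * num_closed q.-1.
Proof.
move=> q1 jq; rewrite /num_closed big_distrr /=.
by apply: leq_sum => z _; apply: closed_prod_le.
Qed.

(** By log-convexity a bound on the last ratio bounds all earlier ones, and the ratios telescope
    down to [num_closed 0]. *)
Lemma num_closed_le q Q : 0 < #|V| -> num_closed q.+1 <= Q * num_closed q ->
  num_closed q.+1 <= #|V| * Q ^ q.+1.
Proof.
move=> V0 h.
have ratio i : i <= q -> num_closed i.+1 <= Q * num_closed i.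
  move=> iq; rewrite -(leq_pmul2r (num_closed_gt0 q V0)).
  apply: leq_trans (log_convex_shift _ _ iq) _.
  - by move=> k; apply: num_closed_gt0.
  - exact: num_closed_log_convex.
  by rewrite mulnAC mulnC leq_mul2r h orbT.
suff H i : i <= q.+1 -> num_closed i <= #|V| * Q ^ i by apply: H.
elim: i => [|i IH] iq; first by rewrite num_closed0 muln1.
apply: leq_trans (ratio i iq) _.
by rewrite expnS mulnCA leq_mul2l IH ?orbT // ltnW.
Qed.

End ClosedWalks.

(** * Sums over walks, and walks that revisit a vertex or hit a set *)

Section WalkSums.
Local Open Scope nat_scope.
Variables (V : finType) (e : rel V).

(** Walks are listed without their start, as in [path]; a boolean [f] counts the walks with a given
    property. *)
Fixpoint walk_sum (j : nat) (x : V) (f : seq V -> nat) : nat :=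
  if j is j'.+1 then \sum_z e x z * walk_sum j' z (fun p => f (z :: p))
  else f [::].

Lemma walk_sum_le j x (f g : seq V -> nat) :
    (forall p, size p = j -> path e x p -> f p <= g p) ->
  walk_sum j x f <= walk_sum j x g.
Proof.
elim: j x f g => [|j IH] x f g fg /=; first exact: fg.
apply: leq_sum => z _; case exz: (e x z); rewrite ?mul0n // !mul1n.
by apply: IH => p sp ep; apply: fg; rewrite /= ?sp ?exz.
Qed.

Lemma eq_walk_sum j x (f g : seq V -> nat) :
    (forall p, size p = j -> f p = g p) -> walk_sum j x f = walk_sum j x g.
Proof.
by move=> fg; apply/eqP; rewrite eqn_leq !walk_sum_le // => p sp _; rewrite fg.
Qed.

Lemma walk_sumD j x (f g : seq V -> nat) :
  walk_sum j x (fun p => f p + g p) = walk_sum j x f + walk_sum j x g.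
Proof.
elim: j x f g => [|j IH] x f g //=.
by rewrite -big_split /=; apply: eq_bigr => z _; rewrite IH mulnDr.
Qed.

Lemma walk_sum_sum (I : finType) (P : pred I) j x (f : I -> seq V -> nat) :
  walk_sum j x (fun p => \sum_(i | P i) f i p)
    = \sum_(i | P i) walk_sum j x (f i).
Proof.
elim: j x f => [|j IH] x f //=.
rewrite exchange_big /=; apply: eq_bigr => z _.
by rewrite IH big_distrr.
Qed.

Lemma walk_sum_mull c j x (f : seq V -> nat) :
  walk_sum j x (fun p => c * f p) = c * walk_sum j x f.
Proof.
elim: j x f => [|j IH] x f //=.
by rewrite big_distrr /=; apply: eq_bigr => z _; rewrite IH mulnCA.
Qed.

Lemma walk_sum_last j x y : walk_sum j x (fun p => last x p == y) = nwalks e j x y.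
Proof. by elim: j x => //= j IH x; apply: eq_bigr => z _; rewrite IH. Qed.

Lemma walk_sum_cat i j x f :
  walk_sum (i + j) x f =
  walk_sum i x (fun p => walk_sum j (last x p) (fun p' => f (p ++ p'))).
Proof. by elim: i x f => //= i IH x f; apply: eq_bigr => z _; rewrite IH. Qed.

Lemma walk_sum_via i j x z f :
  walk_sum (i + j) x (fun p => (last x (take i p) == z) * f (drop i p))
    = nwalks e i x z * walk_sum j z f.
Proof.
rewrite walk_sum_cat -walk_sum_last [RHS]mulnC -walk_sum_mull.
apply: eq_walk_sum => p sp.
rewrite [LHS](@eq_walk_sum _ _ _ (fun p' => (last x p == z) * f p')); last first.
  by move=> p' _; rewrite take_size_cat // drop_size_cat.
by rewrite walk_sum_mull mulnC; case: eqP => [->|] //; rewrite !muln0.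
Qed.

Lemma walk_sum_gt0 j x f : 0 < walk_sum j x f ->
  exists p, [/\ size p = j, path e x p & 0 < f p].
Proof.
elim: j x f => [|j IH] x f /=; first by exists [::].
rewrite lt0n sum_nat_eq0 negb_forall => /existsP[z].
rewrite implyTb muln_eq0 negb_or -!lt0n lt0b => /andP[exz /IH[p [sp ep fp]]].
by exists (z :: p); rewrite /= sp exz.
Qed.

Lemma nwalks_gt0P j x y :
  reflect (exists p, [/\ size p = j, path e x p & last x p = y])
          (0 < nwalks e j x y).
Proof.
apply: (iffP idP) => [|[p [sp ep lp]]].
  rewrite -walk_sum_last => /walk_sum_gt0[p [sp ep]].
  by rewrite lt0b => /eqP lp; exists p.
elim: p x j sp ep lp => [|z p IH] x [|j] //=; first by move=> _ _ ->; rewrite eqxx.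
move=> [sp] /andP[exz ep] lp; rewrite (bigD1 z) //= exz mul1n ltn_addr //.
exact: IH.
Qed.

(** Counts walks together with a marked loop: the walk is at [z] after [a] steps and again [c.+1]
    steps later, the shift making the loop nonempty. *)
Definition closing_walks (q : nat) (x y : V) : nat :=
  \sum_(a < q) \sum_(c < q | a + c < q)
    \sum_z nwalks e a x z * (nwalks e c.+1 z z * nwalks e (q - (a + c.+1)) z y).

Lemma nonuniq_walks_le q x y :
  walk_sum q x (fun p => ~~ uniq (x :: p) && (last x p == y))
    <= closing_walks q x y.
Proof.
pose F a c z p := (last x (take a p) == z) * ((last z (take c.+1 (drop a p)) == z)
                     * (last z (drop c.+1 (drop a p)) == y)).
have FE a c z : a + c < q -> walk_sum q x (F a c z) =
    nwalks e a x z * (nwalks e c.+1 z z * nwalks e (q - (a + c.+1)) z y).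
  move=> acq; have {1}-> : q = a + (c.+1 + (q - (a + c.+1))) by lia.
  rewrite /F (walk_sum_via _ _ _ _ (fun p => (last z (take c.+1 p) == z)
                     * (last z (drop c.+1 p) == y))); congr (_ * _).
  by rewrite (walk_sum_via _ _ _ _ (fun p => last z p == y)) walk_sum_last.
apply: (@leq_trans (walk_sum q x (fun p => \sum_(a < q)
    \sum_(c < q | a + c < q) \sum_z F a c z p))); last first.
  rewrite walk_sum_sum leq_eqVlt; apply/orP; left; apply/eqP.
  apply: eq_bigr => a _; rewrite walk_sum_sum; apply: eq_bigr => c acq.
  by rewrite walk_sum_sum; apply: eq_bigr => z _; rewrite FE.
apply: walk_sum_le => p sp ep.
case: (boolP (uniq (x :: p))) => [//|/(uniqPn x)[a [b [ab bp E]]]].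
case: eqP => // lp.
have bq : b <= q by move: bp; rewrite /= sp ltnS.
have aq : a < q by lia.
have cq : b - a.+1 < q by lia.
have nthE i : i <= q -> nth x (x :: p) i = last x (take i p).
  move=> iq; rewrite (last_nth x) size_takel ?sp //.
  by rewrite -[x :: take i p]/(take i.+1 (x :: p)) nth_take.
rewrite (bigD1 (Ordinal aq)) //= (bigD1 (Ordinal cq)) /=; last by lia.
rewrite (bigD1 (last x (take a p))) //= -!addnA ltn_addr //.
have acb : a + (b - a.+1).+1 = b by lia.
have Eb : last (last x (take a p)) (take (b - a.+1).+1 (drop a p)) = last x (take a p).
  by rewrite -last_cat -takeD acb -!nthE ?(ltnW aq).
rewrite /F eqxx mul1n Eb eqxx mul1n -{1}Eb drop_drop addnC acb.
by rewrite -last_cat -takeD acb -last_cat cat_take_drop lp eqxx.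
Qed.

Lemma hitting_walks_le q x y (S : {set V}) :
  walk_sum q x (fun p => has (mem S) (take q.-1 p) && (last x p == y))
    <= \sum_(i < q.-1) \sum_(z in S) nwalks e i.+1 x z * nwalks e (q - i.+1) z y.
Proof.
pose F i z p := (last x (take i.+1 p) == z) * (last z (drop i.+1 p) == y).
apply: (@leq_trans (walk_sum q x (fun p => \sum_(i < q.-1) \sum_(z in S) F i z p))); last first.
  rewrite walk_sum_sum leq_eqVlt; apply/orP; left; apply/eqP.
  apply: eq_bigr => i _; rewrite walk_sum_sum; apply: eq_bigr => z _.
  have {1}-> : q = i.+1 + (q - i.+1) by have := ltn_ord i; lia.
  by rewrite (walk_sum_via _ _ _ _ (fun p => last z p == y)) walk_sum_last.
apply: walk_sum_le => p sp ep.
case: (boolP (has _ _)) => [/(has_nthP x)[i]|//]; rewrite size_takel ?sp ?leq_pred // => iq.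
rewrite nth_take // => zS; case: eqP => // lp.
have E : nth x p i = last x (take i.+1 p).
  rewrite (last_nth x) size_takel /= ?nth_take // sp; lia.
rewrite (bigD1 (Ordinal iq)) //= (bigD1 (nth x p i)) //= -!addnA ltn_addr //.
by rewrite /F E eqxx mul1n -last_cat cat_take_drop lp eqxx.
Qed.

End WalkSums.

Arguments nwalks : simpl never.

(** * Linked pairs, and closed walks over the non-linked ones *)

Section Linked.
Local Open Scope nat_scope.
Variables (V : finType) (e : rel V).
Hypotheses (e_sym : symmetric e) (e_irr : irreflexive e).
Variable D : nat.
Hypothesis degD : forall x, \sum_y e x y <= D.
Hypothesis deg_gt0 : forall x, 0 < \sum_y e x y.
Variables (s q : nat).
Hypothesis q_gt1 : 1 < q.

Local Notation wk := (nwalks e).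

(** As [p] omits the start and [take q.-1] drops the end, only inner vertices must avoid [S]. *)
Definition avoiding_path (S : {set V}) (x y : V) : bool :=
  [exists p : q.-tuple V, [&& path e x p, last x p == y, uniq (x :: p)
    & ~~ has (mem S) (take q.-1 p)]].

Definition linked (x y : V) : bool :=
  (x != y) && [forall S : {set V}, (#|S| <= s) ==> avoiding_path S x y].

(** A walk with a marked loop, closed up by a second walk between the same ends, splits at [z] into
    two closed walks of total length [2q]. *)
Lemma sum_closing_walks_le :
  \sum_x \sum_y closing_walks e q x y * wk q x y
    <= q ^ 2 * (D * num_closed e q.-1).
Proof.
have -> : \sum_x \sum_y closing_walks e q x y * wk q x y =
   \sum_(a < q) \sum_(c < q | a + c < q)
     \sum_z wk c.+1 z z * wk (q + q - c.+1) z z.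
  transitivity (\sum_x \sum_y \sum_(a < q) \sum_(c < q | a + c < q)
    \sum_z wk a x z * (wk c.+1 z z * wk (q - (a + c.+1)) z y) * wk q x y).
    apply: eq_bigr => x _; apply: eq_bigr => y _.
    rewrite big_distrl; apply: eq_bigr => a _.
    rewrite big_distrl; apply: eq_bigr => c _.
    by rewrite big_distrl.
  under eq_bigr do rewrite exchange_big /=.
  rewrite exchange_big /=; apply: eq_bigr => a _.
  under eq_bigr do rewrite exchange_big /=.
  rewrite exchange_big /=; apply: eq_bigr => c ac.
  under eq_bigr do rewrite exchange_big /=.
  rewrite exchange_big /=; apply: eq_bigr => z _.
  have -> : q + q - c.+1 = (q - (a + c.+1)) + (q + a) by lia.
  rewrite nwalksD big_distrr /= exchange_big /=.
  apply: eq_bigr => y _; rewrite nwalksD !big_distrr /=.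
  apply: eq_bigr => x _; rewrite (nwalksC e_sym q y) (nwalksC e_sym a x).
  by ring.
apply: (@leq_trans (\sum_(a < q) \sum_(c < q) D * num_closed e q.-1)).
  apply: leq_sum => a _; rewrite [X in X <= _]big_mkcond /=.
  apply: leq_sum => c _; case: ifP => // ac.
  by apply: sum_closed_prod_le => //; lia.
by rewrite !sum_nat_const !card_ord mulnA mulnn.
Qed.

(** Two walks between the same ends that are at [z] at the same time form two closed walks at [z],
    of lengths [2(i + 1)] and [2(q - i - 1)]. *)
Lemma sum_crossing_walks_le :
  \sum_x \sum_y \sum_(i < q.-1) \sum_z (wk i.+1 x z * wk (q - i.+1) z y) ^ 2
    <= q * (D * num_closed e q.-1).
Proof.
under eq_bigr do rewrite exchange_big /=.
rewrite exchange_big /=.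
apply: (@leq_trans (\sum_(i < q.-1) D * num_closed e q.-1)); last first.
  by rewrite sum_nat_const card_ord leq_mul2r leq_pred orbT.
apply: leq_sum => i _; under eq_bigr do rewrite exchange_big /=.
rewrite exchange_big /=.
have iq := ltn_ord i.
apply: leq_trans (sum_closed_prod_le e_sym e_irr degD deg_gt0 (j := i.+1 + i.+1) q_gt1 _); last by lia.
apply: leq_sum => z _.
have -> : q + q - (i.+1 + i.+1) = (q - i.+1) + (q - i.+1) by lia.
rewrite !closed_even // big_distrl /=; apply: leq_sum => x _.
rewrite big_distrr /=; apply: leq_sum => y _.
by rewrite expnMn (nwalksC e_sym i.+1 x).
Qed.

(** Some small [S] meets every path, so each walk has a marked loop or passes through [S]. Whichever
    kind makes up at least half of the walks gives one of the two terms; the second uses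
    Cauchy-Schwarz over positions and over [S]. *)
Lemma not_linked_le x y : x != y -> ~~ linked x y ->
  wk q x y ^ 2 <= 2 * (closing_walks e q x y * wk q x y) +
    4 * (q * s) * \sum_(i < q.-1) \sum_z (wk i.+1 x z * wk (q - i.+1) z y) ^ 2.
Proof.
rewrite /linked => -> /=; rewrite negb_forall => /existsP[S].
rewrite negb_imply => /andP[Ss noP].
set N := closing_walks _ _ _ _; set H := \sum_(i < q.-1) _.
pose h := \sum_(i < q.-1) \sum_(z in S) wk i.+1 x z * wk (q - i.+1) z y.
have le_w : wk q x y <= N + h.
  rewrite -walk_sum_last.
  apply: leq_trans (leq_add (nonuniq_walks_le e q x y) (hitting_walks_le e q x y S)).
  rewrite -walk_sumD; apply: walk_sum_le => p sp ep.
  case: eqP => [lp|_]; last by rewrite !andbF.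
  rewrite !andbT.
  case: (boolP (uniq (x :: p))) => // up.
  case: (boolP (has (mem S) (take q.-1 p))) => // hp.
  move: noP; rewrite negb_exists => /forallP/(_ (tcast sp (in_tuple p))).
  by rewrite val_tcast ep up hp lp eqxx.
have le_h : h ^ 2 <= q * s * H.
  apply: leq_trans (sum_sqr_le _ _) _.
  have -> : #|(fun=> true) : pred 'I_q.-1| = q.-1.
    by rewrite -[RHS]card_ord; apply: eq_card.
  rewrite -mulnA; apply: leq_mul; first exact: leq_pred.
  rewrite /H big_distrr /=; apply: leq_sum => i _.
  apply: leq_trans (sum_sqr_le _ _) _; apply: leq_mul => //.
  by rewrite [X in _ <= X](bigID (mem S)) /= leq_addr.
have [wN|Nw] := leqP (wk q x y) (2 * N).
  by rewrite mulnA -mulnn (leq_trans (leq_mul wN (leqnn _))) // leq_addr.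
apply: leq_trans (leq_addl _ _).
rewrite -mulnA (leq_trans _ (leq_mul (leqnn 4) le_h)) // -(expnMn 2 h 2) leq_sqr.
by move: le_w Nw; lia.
Qed.

(** The summands of the constant come from the diagonal, from marked loops and from crossings, in
    this order. *)
Lemma sum_not_linked_le :
  \sum_x \sum_(y | ~~ linked x y) wk q x y ^ 2
    <= (1 + 2 * q ^ 2 + 4 * q ^ 2 * s) * (D * num_closed e q.-1).
Proof.
pose H x y := \sum_(i < q.-1) \sum_z (wk i.+1 x z * wk (q - i.+1) z y) ^ 2.
apply: (@leq_trans (\sum_x \sum_y ((x == y) * wk q x y ^ 2 +
   (2 * (closing_walks e q x y * wk q x y) + 4 * (q * s) * H x y)))).
  apply: leq_sum => x _; rewrite [X in X <= _]big_mkcond /=.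
  apply: leq_sum => y _; case: ifP => // nl.
  have [xy|xy] := eqVneq x y; first by rewrite mul1n leq_addr.
  by rewrite mul0n add0n; apply: not_linked_le.
under eq_bigr do rewrite big_split /=.
rewrite big_split /= -addnA mulnDl mul1n mulnDl; apply: leq_add.
  apply: leq_trans (sum_closed_prod_le e_sym e_irr degD deg_gt0 (j := q) q_gt1 _); last by lia.
  apply: leq_sum => x _; rewrite (bigD1 x) //= eqxx mul1n big1 ?addn0.
    by rewrite addnK mulnn.
  by move=> y; rewrite eq_sym => /negbTE->.
under eq_bigr do rewrite big_split /= -!big_distrr /=.
rewrite big_split -!big_distrr /=; apply: leq_add.
  by rewrite -mulnA leq_mul2l sum_closing_walks_le orbT.
apply: leq_trans (leq_mul (leqnn _) sum_crossing_walks_le) _.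
by rewrite leq_eqVlt; apply/orP; left; apply/eqP; ring.
Qed.

(* [nwalks e (k + k)] is the Gram matrix of the rows of [nwalks e k], so the
   sum of its squares over non-linked pairs splits into quadratic forms with
   nonnegative weights, each of which is large by Turan's theorem. *)
Lemma linked_clique (k t : nat) : q = k + k ->
    (forall c : seq V, size c = t -> pairwise linked c -> False) ->
  num_closed e q <= 4 ^ t * (1 + 2 * q ^ 2 + 4 * q ^ 2 * s) * D * num_closed e q.-1.
Proof.
move=> qk noK.
apply: (@leq_trans (4 ^ t * \sum_x \sum_(y | ~~ linked x y) wk q x y ^ 2)); last first.
  by rewrite -mulnA -mulnA leq_mul2l sum_not_linked_le orbT.
(* The square of an inner product is the inner product of tensor squares, here with the nonnegative
   coordinates [g w]. *)
pose g (w : V * V) x := wk k x w.1 * wk k x w.2.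
have sqrE x y : wk q x y ^ 2 = \sum_w g w x * g w y.
  rewrite qk nwalksD -mulnn big_distrlr /= pair_bigA /=.
  by apply: eq_bigr => w _; rewrite /g !(nwalksC e_sym k y); ring.
have -> : \sum_x \sum_(y | ~~ linked x y) wk q x y ^ 2 =
    \sum_w \sum_x \sum_(y | ~~ linked x y) g w x * g w y.
  rewrite exchange_big /=; apply: eq_bigr => x _.
  by rewrite exchange_big /=; apply: eq_bigr => y _.
rewrite big_distrr /=; apply: (@leq_trans (\sum_w (\sum_x g w x) ^ 2)); last first.
  by apply: leq_sum => w _; apply: weighted_turan => c sc pc _; apply: noK pc.
rewrite /num_closed leq_eqVlt; apply/orP; left; apply/eqP.
transitivity (\sum_x \sum_y \sum_w g w x * g w y).
  apply: eq_bigr => x _; rewrite closed_even //.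
  by apply: eq_bigr => y _.
under [RHS]eq_bigr do rewrite -mulnn big_distrlr /=.
rewrite [RHS]exchange_big /=; apply: eq_bigr => x _.
by rewrite [RHS]exchange_big.
Qed.

End Linked.

(** * Greedy choice of internally disjoint paths *)

Section Routes.
Local Open Scope nat_scope.
Variables (V : finType) (e : rel V) (q : nat).

Definition route (x y : V) (P : nat -> V) : Prop :=
  [/\ P 0 = x, P q = y & forall i, i < q -> e (P i) (P i.+1)].

Lemma path_route x y p : size p = q -> path e x p -> last x p = y ->
  route x y (nth x (x :: p)).
Proof.
move=> sp ep lp; split=> //; first by rewrite -lp (last_nth x) sp.
by move=> i iq; move/(pathP x): ep => /(_ i); rewrite sp => /(_ iq).
Qed.

Lemma avoiding_route S x y : avoiding_path e q S x y ->
  exists P, [/\ route x y P,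
    forall i j, 0 < i < q -> 0 < j < q -> P i = P j -> i = j
    & forall i, 0 < i < q -> P i \notin S].
Proof.
case/existsP => p /and4P[ep /eqP lp up /hasPn hp].
exists (nth x (x :: p)); split.
- by apply: path_route lp => //; rewrite size_tuple.
- move=> i j /andP[_ iq] /andP[_ jq]; move/(uniqP x): up; apply.
    by rewrite inE [size _]/= size_tuple ltnS ltnW.
  by rewrite inE [size _]/= size_tuple ltnS ltnW.
move=> [|i] //= iq; apply: hp.
rewrite -(@nth_take q.-1); last by lia.
by apply: mem_nth; rewrite size_takel ?size_tuple; lia.
Qed.

(** Each new path avoids [B] and everything on the earlier paths; [s] is large enough for this set
    at every stage. *)
Lemma disjoint_routes (I : eqType) (es : seq I) (x y : I -> V) (B : {set V}) s :
    uniq es -> #|B| + size es * q <= s ->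
    (forall i, i \in es -> forall S : {set V}, #|S| <= s ->
       avoiding_path e q S (x i) (y i)) ->
  exists P : I -> nat -> V,
    [/\ forall i, i \in es -> route (x i) (y i) (P i),
        forall i j a c, i \in es -> j \in es -> 0 < a < q -> 0 < c < q ->
          P i a = P j c -> i = j /\ a = c
      & forall i a, i \in es -> 0 < a < q -> P i a \notin B].
Proof.
elim: es => [|i es IH] /=; first by exists (fun i _ => x i).
case/andP=> ies ues les av.
have [||P [P1 P2 P3]] := IH ues.
- by apply: leq_trans les; rewrite leq_add2l leq_mul2r leqnSn orbT.
- by move=> j jes; apply: av; rewrite inE jes orbT.
pose used := [seq P j a | j <- es, a <- iota 0 q].
have /avoiding_route[Q [Q1 Q2 Q3]] :
    avoiding_path e q (B :|: [set z | z \in used]) (x i) (y i).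
  apply: av; first by rewrite inE eqxx.
  apply: leq_trans (leq_card_setU _ _) _; apply: leq_trans les.
  rewrite leq_add2l cardsE; apply: leq_trans (card_size _) _.
  by rewrite size_allpairs size_iota leq_mul2r leqnSn orbT.
have Qused j a c : j \in es -> 0 < a < q -> 0 < c < q -> Q a <> P j c.
  move=> jes aq /andP[_ cq] E; have := Q3 a aq.
  rewrite E !inE negb_or => /andP[_]; apply/negP; rewrite negbK.
  by apply: allpairs_f => //; rewrite mem_iota.
exists (fun j => if j == i then Q else P j); split.
- move=> j; rewrite inE; case: eqVneq => [->|_] //= jes; exact: P1.
- move=> j l a c; rewrite !inE.
  case: eqVneq => [->|ji] /= jes; case: eqVneq => [->|li] /= les' aq cq E.
  + by split=> //; apply: Q2.
  + by case: (Qused _ _ _ les' aq cq E).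
  + by case: (Qused _ _ _ jes cq aq (esym E)).
  + exact: P2.
move=> j a; rewrite inE; case: eqVneq => [->|_] /= jes aq; last exact: P3.
by have := Q3 a aq; rewrite inE negb_or => /andP[].
Qed.

End Routes.

(** * From routes, or a linked clique, to a copy of the subdivision *)

Section Embedding.
Local Open Scope nat_scope.

Lemma subdivision_copy (F G : sgraph) (q : nat) (b : F -> G)
    (P : edge F -> nat -> G) :
    0 < q -> injective b ->
    (forall f, route (@adj G) q (b (val f).1) (b (val f).2) (P f)) ->
    (forall f f' i j, 0 < i < q -> 0 < j < q -> P f i = P f' j -> f = f' /\ i = j) ->
    (forall f i x, 0 < i < q -> P f i <> b x) ->
  contains_copy (subdivision F q.-1) G.
Proof.
move=> q0 binj Pr Pinj Pb.
(* New vertices on an edge are numbered from 0, hence the position [i.+1] on the route. *)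
pose f (v : sub_vertex F q.-1) : G :=
  match v with inl x => b x | inr (g, i) => P g i.+1 end.
have oq (i : 'I_q.-1) : 0 < i.+1 < q by have := ltn_ord i; lia.
have fP g i : i <= q -> f (path_vertex q.-1 g i) = P g i.
  have [P0 Pq _] := Pr g.
  case: i => [|i] iq /=; first by rewrite P0.
  case: insubP => [u _ ui|]; first by rewrite /= ui.
  rewrite -leqNgt => iq'; have -> : i.+1 = q by lia.
  by rewrite Pq.
exists f; split.
  move=> [x|[g i]] [y|[h j]] //= E.
  - by rewrite (binj _ _ E).
  - by case: (Pb h j.+1 x).
  - by case: (Pb g i.+1 y).
  by have [-> [/val_inj ->]] := Pinj _ _ _ _ (oq i) (oq j) E.
move=> u v /existsP[g /existsP[i]].
have iq : i < q by have := ltn_ord i; lia.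
have [_ _ Padj] := Pr g.
have A : adj (f (path_vertex q.-1 g i)) (f (path_vertex q.-1 g i.+1)).
  by rewrite !fP ?(ltnW iq) //; apply: Padj.
by case/orP=> /andP[/eqP-> /eqP->] //; rewrite adj_sym.
Qed.

(** Branch vertices follow the enumeration of [F], which also orients its edges, so the ordered
    relation [pairwise] applies. The bound on [s] covers branch vertices and routes. *)
Lemma clique_copy (F G : sgraph) (q s : nat) (c : seq G) :
    0 < q -> #|F| + #|edge F| * q <= s -> size c = #|F| ->
    pairwise (linked (@adj G) s q) c -> 
  contains_copy (subdivision F q.-1) G.
Proof.
move=> q0 hs sc pc.
have uc : uniq c.
  rewrite uniq_pairwise; apply: sub_pairwise pc.
  by move=> x y /andP[].
(* If [F] has no vertices, [G] may have none either, and [nth] would lack a default. *)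
have [x0 _|F0] := pickP F; last first.
  have e0 (f : edge F) : False by have := F0 (val f).1.
  have b : F -> G by move=> x; have := F0 x.
  have P : edge F -> nat -> G by move=> /e0.
  apply: (@subdivision_copy F G q b P) => // x; first [by have := F0 x | by case: (e0 x)].
have rF (x : F) : enum_rank x < size c by rewrite sc ltn_ord.
have v0 : G by case: c {pc uc} sc rF => [|v ? _ _]; [move=> _ /(_ x0)|exact: v].
pose b (x : F) := nth v0 c (enum_rank x).
have binj : injective b.
  by move=> x y /eqP; rewrite nth_uniq // => /eqP/val_inj/enum_rank_inj.
have av (f : edge F) : f \in enum (edge F) -> forall S : {set G}, #|S| <= s ->
     avoiding_path (@adj G) q S (b (val f).1) (b (val f).2).
  move=> _ S Ss; have /andP[_ lf] := valP f.
  have /(pairwiseP v0)/(_ _ _ (rF _) (rF _) lf)/andP[_] := pc.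
  by move=> /forallP/(_ S)/implyP/(_ Ss).
have [|P [P1 P2 P3]] := disjoint_routes (B := [set b x | x : F]) (enum_uniq _) _ av.
  rewrite -cardE; apply: leq_trans hs; rewrite leq_add2r.
  exact: leq_imset_card.
apply: (@subdivision_copy F G q b P) => //.
- by move=> f; apply: P1; rewrite mem_enum.
- by move=> f f' i j iq jq; apply: P2; rewrite ?mem_enum.
move=> f i x iq E; have := P3 f i; rewrite mem_enum E => /(_ isT iq).
by rewrite imset_f.
Qed.

End Embedding.

(** * Crowded pairs are few, good pairs are many *)

Section Sparse.
Local Open Scope nat_scope.
Variables (V : finType) (e : rel V).
Hypothesis e_sym : symmetric e.
Variables D q mu nu : nat.
Hypothesis degD : forall x, \sum_y e x y <= D.
Hypothesis D_gt0 : 0 < D.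
Hypothesis V_gt0 : 0 < #|V|.

Local Notation wk := (nwalks e).
Local Notation n := #|V|.

(* The last clause bounds the number of vertices b for which a q-walk from x
   to b and a q-walk from y to b meet before b. *)
Definition crowded (x y : V) : bool :=
  [|| mu < wk q x y, 0 < closing_walks e q x y |
   [exists i : 'I_q, exists j : 'I_q, [&& 0 < i, 0 < j &
      n < nu * (wk (q - i + (q - j)) x y * D ^ minn i j)]]].

Definition good (x y : V) : bool := (0 < wk q x y) && ~~ crowded x y.

(** From a fixed [z] the loop and the two outer pieces take [q] steps in all, one of which is forced
    by closing the loop. *)
Lemma sum_closing_le : \sum_x \sum_y closing_walks e q x y <= q ^ 2 * (n * D ^ q.-1).
Proof.
have -> : \sum_x \sum_y closing_walks e q x y =
   \sum_(a < q) \sum_(c < q | a + c < q) \sum_z \sum_x \sum_y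
     wk a x z * (wk c.+1 z z * wk (q - (a + c.+1)) z y).
  under eq_bigr do rewrite exchange_big /=.
  rewrite exchange_big /=; apply: eq_bigr => a _.
  under eq_bigr do rewrite exchange_big /=.
  rewrite exchange_big /=; apply: eq_bigr => c ac.
  under eq_bigr do rewrite exchange_big /=.
  by rewrite exchange_big.
apply: (@leq_trans (\sum_(a < q) \sum_(c < q) n * D ^ q.-1)); last first.
  by rewrite !sum_nat_const !card_ord mulnA mulnn.
apply: leq_sum => a _; rewrite [X in X <= _]big_mkcond /=.
apply: leq_sum => c _; case: ifP => // ac.
rewrite -sum_nat_const; apply: leq_sum => z _.
under eq_bigr do rewrite -!big_distrr /=; rewrite -big_distrl /=.
have -> : q.-1 = a + (c + (q - (a + c.+1))) by lia.
rewrite !expnD; apply: leq_mul.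
  under eq_bigr do rewrite (nwalksC e_sym).
  exact: sum_nwalks_le.
by apply: leq_mul; [apply: nwalksS_le | apply: sum_nwalks_le].
Qed.

Definition num_crowded : nat := \sum_x \sum_y crowded x y.

(** Each reason for being crowded accounts for at most [n ^ 2 / (3 * La)] pairs: the first by
    Chebyshev, which dictates [mu], the other two by Markov. *)
Lemma num_crowded_le La c1 :
    0 < La -> 0 < c1 -> mu = 3 * La * c1 ->
    \sum_x \sum_y wk q x y ^ 2 <= c1 ^ 2 * n ^ 2 ->
    3 * La * (q ^ 2 * D ^ q.-1) <= n ->
    3 * La * (q ^ 2 * (nu * D ^ (q + q).-1)) <= n ^ 2 ->
  La * num_crowded <= n ^ 2.
Proof.
move=> La0 c0 muE T H2 H3.
pose A x y : nat := mu < wk q x y.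
pose C x y : nat := \sum_(i < q) \sum_(j < q) [&& 0 < i, 0 < j &
      n < nu * (wk (q - i + (q - j)) x y * D ^ minn i j)].
have le1 : num_crowded <= \sum_x \sum_y (A x y + (closing_walks e q x y + C x y)).
  apply: leq_sum => x _; apply: leq_sum => y _; rewrite /crowded /A.
  case: (mu < _) => //=; case: (posnP (closing_walks _ _ _ _)) => [->|c0'] /=.
    case: existsP => // -[i /existsP[j ij]].
    by rewrite /C (bigD1 i) //= (bigD1 j) //= ij.
  by rewrite add0n ltn_addr.
have leA : 3 * La * \sum_x \sum_y A x y <= n ^ 2.
  have : 9 * La ^ 2 * c1 ^ 2 * \sum_x \sum_y A x y <= c1 ^ 2 * n ^ 2.
    apply: leq_trans T; rewrite big_distrr; apply: leq_sum => x _ /=.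
    rewrite big_distrr; apply: leq_sum => y _ /=; rewrite /A.
    case: ltnP => [/ltnW h|_]; last by rewrite muln0.
    by rewrite muln1 -(expnMn 3 La 2) -expnMn -muE leq_sqr.
  rewrite -mulnA mulnCA leq_pmul2l ?expn_gt0 ?c0 //.
  by apply: leq_trans; rewrite leq_mul2r; apply/orP; right; rewrite leq_mul // -{1}[La]expn1 leq_pexp2l.
have leB : 3 * La * \sum_x \sum_y closing_walks e q x y <= n ^ 2.
  apply: leq_trans (leq_mul (leqnn _) sum_closing_le) _.
  rewrite -mulnn; apply: leq_trans (leq_mul (leqnn n) H2).
  by rewrite leq_eqVlt; apply/orP; left; apply/eqP; ring.
have leC : 3 * La * \sum_x \sum_y C x y <= n ^ 2.
  apply: leq_trans H3; rewrite leq_mul2l; apply/orP; right.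
  under eq_bigr do rewrite exchange_big /=.
  rewrite exchange_big /=.
  apply: (@leq_trans (\sum_(i < q) \sum_(j < q) nu * D ^ (q + q).-1)); last first.
    by rewrite !sum_nat_const !card_ord mulnA mulnn.
  apply: leq_sum => i _; under eq_bigr do rewrite exchange_big /=.
  rewrite exchange_big /=; apply: leq_sum => j _.
  have [/andP[i0 j0]|ij] := boolP ((0 < i) && (0 < j)); last first.
    rewrite big1 // => x _; rewrite big1 // => y _.
    by rewrite andbA (negbTE ij).
  rewrite i0 j0 /= -(leq_pmul2l V_gt0).
  apply: (@leq_trans (nu * D ^ minn i j * \sum_x \sum_y wk (q - i + (q - j)) x y)).
    rewrite !big_distrr; apply: leq_sum => x _ /=.
    rewrite !big_distrr; apply: leq_sum => y _ /=.
    by case: ltnP => [/ltnW h|_]; rewrite ?muln0 // muln1 (leq_trans h) // -mulnA (mulnC (D ^ _)).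
  apply: leq_trans (leq_mul (leqnn _) (sum_sum_nwalks_le degD _)) _.
  rewrite mulnCA leq_mul2l; apply/orP; right.
  (* The exponent is [2q] minus the larger of [i] and [j], hence at most [2q - 1]. *)
  rewrite -mulnA leq_mul2l; apply/orP; right; rewrite -expnD leq_pexp2l //.
  by have := ltn_ord i; have := ltn_ord j; lia.
rewrite -(leq_pmul2l (isT : 0 < 3)) mulnA; apply: leq_trans (leq_mul (leqnn _) le1) _.
under eq_bigr do rewrite !big_split /=.
rewrite !big_split /= !mulnDr (_ : 3 * n ^ 2 = n ^ 2 + (n ^ 2 + n ^ 2)); last by ring.
by apply: leq_add; [|apply: leq_add].
Qed.

Variables d k c1 Z : nat.
Hypotheses (d_gt0 : 0 < d) (qk : q = k + k).
Hypothesis degd : forall x, d <= \sum_y e x y.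
Hypothesis energy : \sum_x \sum_y wk q x y ^ 2 <= c1 * (n * d ^ q).
Hypothesis nZ : n <= Z * d ^ q.

(** Cauchy-Schwarz is applied twice: over the ends of the [k]-walks from [B], to bound below the
    number [W] of [q]-walks inside [B]; then over the pairs that these join, against the energy.
    Joined pairs are good or crowded. *)
Lemma card_le_good (B : {set V}) :
  #|B| ^ 4 <= c1 * Z * n ^ 2 * (\sum_(x in B) #|[set y in B | good x y]| + num_crowded).
Proof.
set G := \sum_(x in B) _.
pose W := \sum_(x in B) \sum_(y in B) wk q x y.
have leW : #|B| ^ 2 * d ^ q <= n * W.
  have -> : #|B| ^ 2 * d ^ q = (#|B| * d ^ k) ^ 2.
    by rewrite expnMn -expnM muln2 -addnn -qk.
  have leS : #|B| * d ^ k <= \sum_w \sum_(x in B) wk k x w.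
    rewrite exchange_big /= -sum_nat_const; apply: leq_sum => x _.
    exact: sum_nwalks_ge.
  apply: (@leq_trans ((\sum_w \sum_(x in B) wk k x w) ^ 2)); first by rewrite leq_sqr.
  apply: leq_trans (sum_sqr_le _ _) _.
  rewrite (_ : #|(fun=> true) : pred V| = n); last by apply: eq_card.
  rewrite leq_mul2l; apply/orP; right; rewrite /W.
  under eq_bigr do rewrite -mulnn big_distrlr /=.
  rewrite exchange_big /=; apply: leq_sum => x _.
  rewrite exchange_big /=; apply: leq_sum => y _.
  by rewrite qk nwalksD; apply: leq_sum => w _; rewrite (nwalksC e_sym k y).
pose P (p : V * V) := [&& p.1 \in B, p.2 \in B & 0 < wk q p.1 p.2].
have leP' : #|P| <= G + num_crowded.
  rewrite -sum1_card big_mkcond -(pair_bigA _ (fun x y => if (x, y) \in P then 1 else 0)) /=.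
  rewrite /G /num_crowded [X in _ <= X + _]big_mkcond /= -big_split /=; apply: leq_sum => x _.
  case: ifP => [xB|xB]; last first.
    by rewrite big1 // => y _; rewrite unfold_in /P /= xB.
  rewrite -sum1_card [X in _ <= X + _]big_mkcond /= -big_split /=; apply: leq_sum => y _.
  rewrite -[(x, y) \in P]/(P (x, y)) /P /= xB inE /good.
  by case: (y \in B) => //=; case: (0 < _) => //=; case: crowded.
have leW2 : W ^ 2 <= (G + num_crowded) * (c1 * (n * d ^ q)).
  have -> : W = \sum_(p | P p) wk q p.1 p.2.
    rewrite /W pair_big_dep /= [LHS](bigID (fun p => 0 < wk q p.1 p.2)) /=.
    rewrite addnC big1 => [|p /andP[_]]; last by rewrite lt0n negbK => /eqP.
    by apply: eq_bigl => p; rewrite /P andbA.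
  apply: leq_trans (sum_sqr_le _ _) _; apply: leq_mul => //.
  apply: leq_trans energy; rewrite pair_bigA /= [X in _ <= X](bigID P) /=.
  exact: leq_addr.
have n3 : #|B| ^ 4 * d ^ q <= c1 * n ^ 3 * (G + num_crowded).
  have dq : 0 < d ^ q by rewrite expn_gt0 d_gt0.
  rewrite -(leq_pmul2r dq).
  apply: (@leq_trans ((n * W) ^ 2)).
    have -> : #|B| ^ 4 * d ^ q * d ^ q = (#|B| ^ 2 * d ^ q) ^ 2 by ring.
    by rewrite leq_sqr.
  rewrite expnMn; apply: leq_trans (leq_mul (leqnn _) leW2) _.
  by rewrite leq_eqVlt; apply/orP; left; apply/eqP; ring.
rewrite -(leq_pmul2r V_gt0).
apply: (@leq_trans (Z * (#|B| ^ 4 * d ^ q))).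
  by rewrite mulnCA leq_mul2l nZ orbT.
apply: leq_trans (leq_mul (leqnn _) n3) _.
by rewrite leq_eqVlt; apply/orP; left; apply/eqP; ring.
Qed.

(** By averaging, at least [n / la'] vertices of [B] have [n / la'] good partners in [B], too many
    to lie in [X]. The factor 4 pays for the crowded pairs and for the vertices with few
    partners. *)
Lemma popular_vertex (B X : {set V}) la :
    n <= la * #|B| ->
    4 * la ^ 4 * c1 * Z * num_crowded <= n ^ 2 ->
    4 * la ^ 4 * c1 * Z * #|X| < n ->
  exists2 x, x \in B :\: X & n <= 4 * la ^ 4 * c1 * Z * #|[set y in B | good x y]|.
Proof.
set la' := 4 * la ^ 4 * c1 * Z => nB C X'.
pose g x := #|[set y in B | good x y]|.
pose cand := [set x in B | n <= la' * g x].
have n0 : 0 < n ^ 2 by rewrite expn_gt0 V_gt0.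
have le2 : 2 * n ^ 2 <= la' * \sum_(x in B) g x.
  have : n ^ 2 * n ^ 2 <= n ^ 2 * (la ^ 4 * c1 * Z * (\sum_(x in B) g x + num_crowded)).
    rewrite -expnD; apply: (@leq_trans ((la * #|B|) ^ 4)); first by rewrite leq_exp2r.
    rewrite expnMn; apply: leq_trans (leq_mul (leqnn _) (card_le_good B)) _.
    by rewrite leq_eqVlt; apply/orP; left; apply/eqP; rewrite -/(\sum_(x in B) g x); ring.
  rewrite leq_pmul2l // mulnDr => h.
  have laE : la' = 4 * (la ^ 4 * c1 * Z) by rewrite /la'; ring.
  by move: C; rewrite laE -!(mulnA 4); lia.
have lecand : n <= la' * #|cand|.
  rewrite -(leq_pmul2r V_gt0).
  suff : la' * \sum_(x in B) g x <= la' * #|cand| * n + n ^ 2 by move: le2; rewrite -mulnn; lia.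
  apply: (@leq_trans (\sum_(x in B) (la' * (x \in cand) * n + n))).
    rewrite big_distrr; apply: leq_sum => x xB /=.
    rewrite inE xB /=; case: (leqP n (la' * g x)) => [_|/ltnW h]; last by rewrite muln0.
    rewrite muln1; apply: leq_trans (leq_addr _ _).
    by rewrite leq_mul2l max_card orbT.
  rewrite big_split /= sum_nat_const -mulnn; apply: leq_add; last by rewrite leq_mul2r max_card orbT.
  rewrite -big_distrl -big_distrr /= leq_mul2r; apply/orP; right; rewrite leq_mul2l; apply/orP; right.
  rewrite -[X in _ <= X]sum1_card [X in _ <= X]big_mkcond /= [X in X <= _]big_mkcond /=.
  by apply: leq_sum => x _; case: (x \in B); case: (x \in cand).
have /subsetPn[x xc xX] : ~~ (cand \subset X).
  apply/negP => /subset_leq_card h; move: X'; rewrite ltnNge.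
  by rewrite (leq_trans lecand) // leq_mul2l h orbT.
move: xc; rewrite inE => /andP[xB xg]; exists x => //.
by rewrite inE xX.
Qed.

End Sparse.

(** * Cardinality estimates for unions and supports *)

Section CardBound.
Local Open Scope nat_scope.

Lemma leq_card_bigcup (I T : finType) (P : pred I) (S : I -> {set T}) :
  #|\bigcup_(i | P i) S i| <= \sum_(i | P i) #|S i|.
Proof.
elim/big_rec2: _ => [|i m A _ le_Am]; first by rewrite cards0.
by apply: leq_trans (leq_card_setU _ _) _; rewrite leq_add2l.
Qed.

Lemma card_le_sum_fun (T : finType) (S : {set T}) (f : T -> nat) :
  (forall x, x \in S -> 0 < f x) -> #|S| <= \sum_x f x.
Proof.
move=> Sf; rewrite -sum1_card [X in X <= _]big_mkcond /=.
by apply: leq_sum => x _; case: ifP => // /Sf.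
Qed.

End CardBound.

(** * Vertices at which routes could collide *)

Section Collisions.
Local Open Scope nat_scope.
Variables (V : finType) (e : rel V).
Hypothesis e_sym : symmetric e.
Variables D q mu nu : nat.
Hypothesis degD : forall x, \sum_y e x y <= D.
Hypothesis D_gt0 : 0 < D.

Local Notation wk := (nwalks e).
Local Notation n := #|V|.
Local Notation gd := (good e D q mu nu).

(** Contains every vertex of every route that may be chosen between good pairs of [o]. *)
Definition spanned (o : seq V) : {set V} :=
  [set z in o] :|: \bigcup_(p | [&& p.1 \in o, p.2 \in o & gd p.1 p.2])
    \bigcup_(a < q.+1) [set z | 0 < wk a p.1 z * wk (q - a) z p.2].

(** For a new branch vertex outside this set, inner vertices of its routes, which are fewer than [q]
    steps away, stay off the old part. The case [j = 0] keeps the vertex itself off it. *)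
Definition reached (o : seq V) : {set V} :=
  \bigcup_(z in spanned o) \bigcup_(j < q) [set b | 0 < wk j z b].

(** Handles two routes from different old vertices to the same new vertex [b]; [ij] gives the
    distances from the meeting point to [b]. *)
Definition meeting (o : seq V) : {set V} :=
  \bigcup_(p | [&& p.1 \in o, p.2 \in o & gd p.1 p.2])
    \bigcup_(ij : 'I_q * 'I_q | (0 < ij.1) && (0 < ij.2))
      [set b | [exists z, 0 < wk (q - ij.1) p.1 z * wk ij.1 z b *
                              (wk (q - ij.2) p.2 z * wk ij.2 z b)]].

Lemma card_pairs (o : seq V) (P : rel V) :
  #|[pred p : V * V | [&& p.1 \in o, p.2 \in o & P p.1 p.2]]| <= size o ^ 2.
Proof.
apply: (@leq_trans #|[predX mem o & mem o]|).
  by apply: subset_leq_card; apply/fintype.subsetP => p; rewrite !inE => /and3P[-> ->].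
by rewrite cardX -mulnn; apply: leq_mul; apply: card_size.
Qed.

(** A good pair has at most [mu] walks, hence at most [mu] vertices at each of the [q.+1]
    positions. *)
Lemma card_spanned (o : seq V) :
  #|spanned o| <= size o + size o ^ 2 * (q.+1 * mu).
Proof.
apply: leq_trans (leq_card_setU _ _) _; apply: leq_add.
  by rewrite cardsE card_size.
apply: leq_trans (leq_card_bigcup _ _) _.
apply: leq_trans (leq_mul (card_pairs o gd) (leqnn _)).
rewrite -sum_nat_const; apply: leq_sum => p /and3P[_ _ gp].
apply: leq_trans (leq_card_bigcup _ _) _.
rewrite -[q.+1 in X in _ <= X]card_ord -sum_nat_const; apply: leq_sum => a _.
have aq : a <= q by rewrite -ltnS.
apply: (@leq_trans (wk q p.1 p.2)).
  have -> : wk q p.1 p.2 = wk (a + (q - a)) p.1 p.2 by rewrite subnKC.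
  rewrite nwalksD.
  by apply: card_le_sum_fun => z; rewrite inE.
by move: gp; rewrite /good /crowded !negb_or -leqNgt => /and3P[].
Qed.

Lemma card_reached (o : seq V) :
  #|reached o| <= (size o + size o ^ 2 * (q.+1 * mu)) * (q * D ^ q.-1).
Proof.
apply: leq_trans (leq_card_bigcup _ _) _.
apply: leq_trans (leq_mul (card_spanned o) (leqnn _)).
rewrite -sum_nat_const; apply: leq_sum => z _.
apply: leq_trans (leq_card_bigcup _ _) _.
rewrite -[q in q * _]card_ord -sum_nat_const; apply: leq_sum => j _.
apply: (@leq_trans (D ^ j)); last by rewrite leq_pexp2l //; have := ltn_ord j; lia.
apply: leq_trans (sum_nwalks_le degD j z).
by apply: card_le_sum_fun => b; rewrite inE.
Qed.

(** From the meeting point the shorter tail leaves at most [D ^ minn i j] choices of [b], which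
    gives the product that non-crowdedness keeps at most [n / nu]. *)
Lemma card_meeting (o : seq V) :
  nu * #|meeting o| <= size o ^ 2 * q ^ 2 * n.
Proof.
have meet_le i j x y : i <= j ->
    #|[set b | [exists z, 0 < wk (q - i) x z * wk i z b *
                              (wk (q - j) y z * wk j z b)]]|
      <= wk (q - i + (q - j)) x y * D ^ i.
  move=> ij.
  apply: (@leq_trans (\sum_b \sum_z wk (q - i) x z * wk (q - j) z y * wk i z b)).
    apply: card_le_sum_fun => b; rewrite inE => /existsP[z].
    rewrite !muln_gt0 => /andP[/andP[a1 a2] /andP[a3 a4]].
    rewrite (bigD1 z) //= ltn_addr // !muln_gt0 a1 a2.
    by rewrite nwalksC // a3.
  rewrite exchange_big nwalksD big_distrl; apply: leq_sum => z _ /=.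
  by rewrite -big_distrr leq_mul2l sum_nwalks_le ?orbT.
apply: leq_trans (leq_mul (leqnn nu) (leq_card_bigcup _ _)) _.
rewrite big_distrr /= -mulnA.
apply: leq_trans (leq_mul (card_pairs o gd) (leqnn _)).
rewrite -sum_nat_const; apply: leq_sum => -[x y] /and3P[_ _ /= gp].
apply: leq_trans (leq_mul (leqnn nu) (leq_card_bigcup _ _)) _.
rewrite big_distrr /= big_mkcond /=.
apply: (@leq_trans (\sum_(ij : 'I_q * 'I_q) n)); last first.
  by rewrite sum_nat_const card_prod !card_ord mulnn.
apply: leq_sum => -[i j] _ /=; case: ifP => // /andP[i0 j0].
move: gp; rewrite /good /crowded !negb_or => /and4P[_ _ _].
rewrite negb_exists => /forallP/(_ i); rewrite negb_exists => /forallP/(_ j).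
rewrite i0 j0 /= -leqNgt => le_n; apply: leq_trans le_n.
rewrite leq_mul2l; apply/orP; right.
have [ij|ji] := leqP i j; first exact: meet_le.
rewrite addnC nwalksC //; apply: leq_trans (meet_le j i y x (ltnW ji)).
apply: subset_leq_card; apply/fintype.subsetP => b; rewrite !inE => /existsP[z h].
by apply/existsP; exists z; rewrite mulnC.
Qed.

(* Newest vertex first. *)
Fixpoint spread (o : seq V) : bool :=
  if o is b :: o' then
    [&& all (fun x => gd x b) o', b \notin reached o', b \notin meeting o'
      & spread o']
  else true.

Lemma spread_nth v0 o i : spread o -> i < size o ->
  [/\ forall x, x \in drop i.+1 o -> gd x (nth v0 o i),
      nth v0 o i \notin reached (drop i.+1 o)
    & nth v0 o i \notin meeting (drop i.+1 o)].
Proof.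
elim: o i => [|b o IH] [|i] //= /and4P[/allP h1 h2 h3 so] i_lt.
  by rewrite drop0; split.
exact: IH.
Qed.

End Collisions.

(** * Choosing the branch vertices, and embedding from them *)

Section Existence.
Local Open Scope nat_scope.

(* Each chosen branch vertex degrades the inverse density [lam] of the common
   neighbourhood to [4 * lam ^ 4 * c1 * Z]; starting from [lam = 1] this is
   [(4 * c1 * Z) ^ loss i] after [i] choices. *)
Fixpoint loss (t : nat) : nat := if t is i.+1 then (4 * loss i).+1 else 0.

Lemma loss_leq i t : i <= t -> loss i <= loss t.
Proof.
by move=> /subnK<-; elim: (t - i) => // j IH; rewrite addSn /=; lia.
Qed.

(** Induction keeps a set [B] of common good partners of the chosen vertices, of size at least
    [n / lam i]. A popular vertex of [B] is added; the forbidden sets [reached] and [meeting] take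
    up at most [n / (2 * La)] each, the latter strictly less. *)
Lemma exists_spread (V : finType) (e : rel V) (D d q k mu nu c1 Z t : nat) :
    let La := (4 * c1 * Z) ^ loss t in
    symmetric e -> (forall x, \sum_y e x y <= D) -> 0 < D -> 0 < #|V| ->
    0 < d -> q = k + k -> (forall x, d <= \sum_y e x y) ->
    0 < c1 -> 0 < Z ->
    \sum_x \sum_y nwalks e q x y ^ 2 <= c1 * (#|V| * d ^ q) ->
    #|V| <= Z * d ^ q ->
    La * num_crowded e D q mu nu <= #|V| ^ 2 ->
    2 * La * ((t + t ^ 2 * (q.+1 * mu)) * (q * D ^ q.-1)) <= #|V| ->
    2 * La * (t ^ 2 * q ^ 2) < nu ->
  exists2 o : seq V, size o = t & spread e D q mu nu o.
Proof.
move=> La e_sym degD D0 V0 d0 qk degd c0 Z0 T nZ Hc Hn Hm.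
have b0 : 0 < 4 * c1 * Z by rewrite !muln_gt0 c0.
pose lam i := (4 * c1 * Z) ^ loss i.
have lamS i : 4 * lam i ^ 4 * c1 * Z = lam i.+1.
  by rewrite /lam -expnM [in RHS]/= [in RHS]expnS (mulnC 4 (loss i)); ring.
have lam_le i : i <= t -> lam i <= La.
  by move=> it; rewrite leq_pexp2l // loss_leq.
suff H i : i <= t -> exists (o : seq V) (B : {set V}), [/\ size o = i, spread e D q mu nu o,
    #|V| <= lam i * #|B| & forall x y, x \in o -> y \in B -> good e D q mu nu x y].
  by have [vs [_ [so sp _ _]]] := H t (leqnn t); exists vs.
elim: i => [_|i IH it]; first by exists [::], [set: V]; split; rewrite ?cardsT ?mul1n.
have [ o [B [so sp nB gB]]] := IH (ltnW it).
pose X := reached e D q mu nu o :|: meeting e D q mu nu o.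
have so_t : size o <= t by rewrite so ltnW.
have leN : 2 * La * #|reached e D q mu nu o| <= #|V|.
  apply: leq_trans Hn; rewrite leq_mul2l; apply/orP; right.
  apply: leq_trans (card_reached _ _ _ degD D0 o) _; rewrite leq_mul2r; apply/orP; right.
  by apply: leq_add => //; rewrite leq_mul2r leq_sqr so_t orbT.
have leM : 2 * La * #|meeting e D q mu nu o| < #|V|.
  have nu0 : 0 < nu by apply: leq_ltn_trans Hm.
  rewrite -(ltn_pmul2l nu0) mulnCA.
  apply: leq_ltn_trans (leq_mul (leqnn _) (card_meeting e_sym _ _ _ degD o)) _.
  rewrite mulnA; apply: (@leq_ltn_trans (2 * La * (t ^ 2 * q ^ 2) * #|V|)).
    rewrite !leq_mul2r leq_mul2l; apply/orP; right; apply/orP; right.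
    by rewrite leq_mul2r leq_sqr so_t orbT.
  by rewrite ltn_pmul2r.
have ltX : La * #|X| < #|V|.
  have := leq_card_setU (reached e D q mu nu o) (meeting e D q mu nu o).
  rewrite -/X => /(leq_mul (leqnn La)); rewrite mulnDr.
  by move: leN leM; rewrite -!(mulnA 2); lia.
have [x] := popular_vertex (X := X) e_sym D0 V0 d0 qk degd T nZ nB
  (leq_trans (leq_mul (eq_leq (lamS i)) (leqnn _)) (leq_trans (leq_mul (lam_le _ it) (leqnn _)) Hc))
  (leq_ltn_trans (leq_mul (eq_leq (lamS i)) (leqnn _)) (leq_ltn_trans (leq_mul (lam_le _ it) (leqnn _)) ltX)).
rewrite lamS !inE negb_or => /andP[/andP[xN xM] xB] nB'.
exists (x :: o), [set y in B | good e D q mu nu x y]; split=> //.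
- by rewrite /= so.
- by rewrite /= xN xM sp !andbT; apply/allP => y yo; apply: gB.
move=> y z; rewrite !inE => /orP[/eqP->|yo] /andP[zB gz] //.
exact: gB.
Qed.

Lemma route_gt0 (V : finType) (e : rel V) q x y (P : nat -> V) i j :
  route e q x y P -> i <= j <= q -> 0 < nwalks e (j - i) (P i) (P j).
Proof.
case=> _ _ Pe /andP[/subnK <-].
elim: (j - i) => [|l IH] lq; first by rewrite add0n subnn nwalks0 eqxx.
rewrite addSn in lq *; have := IH (ltnW lq).
have -> : (l + i).+1 - i = (l + i - i) + 1 by lia.
rewrite nwalksD => h.
rewrite (bigD1 (P (l + i))) //= ltn_addr // muln_gt0 h.
by rewrite nwalks1 Pe.
Qed.

(** A good pair has no walk with a marked loop, so any of its [q]-walks is already a path. *)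
Lemma good_route (V : finType) (e : rel V) D q mu nu x y :
  good e D q mu nu x y -> exists2 P, route e q x y P &
    forall i j, i <= q -> j <= q -> P i = P j -> i = j.
Proof.
move=> /andP[/nwalks_gt0P[p [sp ep lp]] /norP[_ /norP[ncl _]]].
have rP := path_route sp ep lp; exists (nth x (x :: p)) => //.
move=> i j; wlog: i j / i < j => [H iq jq E|ij _ jq E].
  by case: (ltngtP i j) => // ij; [apply: H|apply/esym/H].
move: ncl; rewrite /closing_walks -eqn0Ngt => /eqP ncl; exfalso.
have iq : i < q by lia.
have cq : j - i.+1 < q by lia.
move: ncl; rewrite (bigD1 (Ordinal iq)) //= (bigD1 (Ordinal cq)) /=; last by lia.
rewrite (bigD1 (nth x (x :: p) i)) //=; apply/eqP; rewrite -lt0n !ltn_addr //.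
rewrite !muln_gt0.
have := route_gt0 (i := 0) (j := i) rP; rewrite subn0 /= => -> //; last by lia.
have := route_gt0 (i := i) (j := j) rP; rewrite -E.
have -> : i + (j - i.+1).+1 = j by lia.
have -> : (j - i.+1).+1 = j - i by lia.
move=> -> //=; last by lia.
have := route_gt0 (i := j) (j := q) rP; rewrite -E.
have [_ -> _] := rP; apply; lia.
Qed.

(** Routes with different newer ends are separated by [reached], routes with a common newer end by
    [meeting]. A branch vertex inside a route is excluded by [reached], or by injectivity if it is
    the newer end of that route. *)
Lemma spread_copy (F G : sgraph) (D q mu nu : nat) (o : seq G) :
    1 < q -> size o = #|F| -> spread (@adj G) D q mu nu o ->
  contains_copy (subdivision F q.-1) G.
Proof.
move=> q1 so sp; have q0 := ltnW q1.
have [x0 _|F0] := pickP F; last first.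
  apply: (@clique_copy F G q (#|F| + #|edge F| * q) [::]) => //=.
  by apply/esym/eq_card0 => x; have := F0 x.
have v0 : G by case: o {sp} so => [|v ? _]; [move=> /esym/eqP; rewrite (cardD1 x0)|exact: v].
have rF (x : F) : enum_rank x < #|F| by apply: ltn_ord.
(* As [o] lists the newest vertex first, the order is reversed: every edge then runs from its older
   end to its newer one, the direction in which [good] holds. *)
pose a (x : F) := #|F| - (enum_rank x).+1.
have aF x : a x < size o by rewrite so ltn_subrL (leq_ltn_trans _ (rF x)).
have a_inj : injective a.
  move=> x y E; apply/enum_rank_inj/val_inj/succn_inj.
  by rewrite -(subKn (rF x)) -(subKn (rF y)) -/(a x) E.
pose b x := nth v0 o (a x).
have b_old x i : i < a x -> b x \in drop i.+1 o.
  move=> ix; rewrite /b -[a x](subnKC ix) -nth_drop; apply: mem_nth.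
  by rewrite size_drop ltn_sub2r // (leq_ltn_trans ix).
have old x y : a x < a y ->
   [/\ good (@adj G) D q mu nu (b y) (b x), b x \notin reached (@adj G) D q mu nu (drop (a x).+1 o)
     & b x \notin meeting (@adj G) D q mu nu (drop (a x).+1 o)].
  by move=> xy; have [h1 h2 h3] := spread_nth v0 sp (aF x); split=> //; apply/h1/b_old.
have reachedI x z j : j < q -> z \in spanned (@adj G) D q mu nu (drop (a x).+1 o) ->
    0 < nwalks (@adj G) j z (b x) -> False.
  move=> jq zs w; have [_ + _] := spread_nth v0 sp (aF x).
  by move/bigcupP; apply; exists z => //; apply/bigcupP; exists (Ordinal jq); rewrite ?inE.
have spannedI x y : a x < a y -> b y \in spanned (@adj G) D q mu nu (drop (a x).+1 o).
  by move=> xy; rewrite inE; apply/orP; left; rewrite inE b_old.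
have b_inj : injective b.
  move=> x y; wlog: x y / a x < a y => [H E|xy E].
    by case: (ltngtP (a x) (a y)) => [||/a_inj] // xy; [apply: H|apply/esym/H].
  by case: (reachedI x (b y) 0 q0 (spannedI _ _ xy)); rewrite nwalks0 E eqxx.
have aE (f : edge F) : a (val f).2 < a (val f).1.
  have /andP[_ lf] := valP f; have := rF (val f).1.
  by have := rF (val f).2; rewrite /a; lia.
have /choice[P HP] : forall f : edge F, exists P,
    route (@adj G) q (b (val f).1) (b (val f).2) P /\
    forall i j, i <= q -> j <= q -> P i = P j -> i = j.
  by move=> f; have [/good_route[P]] := old _ _ (aE f); exists P.
have Pr f := (HP f).1; have Pu f := (HP f).2.
have P0 f : P f 0 = b (val f).1 by case: (Pr f).
have Pq f : P f q = b (val f).2 by case: (Pr f).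
have wb f i : 0 < i < q -> 0 < nwalks (@adj G) (q - i) (P f i) (b (val f).2).
  by move=> /andP[_ iq]; rewrite -Pq; apply: route_gt0 (Pr f) _; rewrite (ltnW iq) leqnn.
have wa f i : 0 < i < q -> 0 < nwalks (@adj G) i (b (val f).1) (P f i).
  move=> /andP[_ iq]; have := route_gt0 (i := 0) (j := i) (Pr f).
  by rewrite subn0 P0 => -> //; rewrite (ltnW iq).
have spannedP x f i : a x < a (val f).2 -> 0 < i < q ->
    P f i \in spanned (@adj G) D q mu nu (drop (a x).+1 o).
  move=> xf iq; rewrite inE; apply/orP; right.
  apply/bigcupP; exists (b (val f).1, b (val f).2) => /=.
    have [g _ _] := old _ _ (aE f).
    by rewrite g !b_old // (ltn_trans xf) // aE.
  have iq' : i < q.+1 by lia.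
  by apply/bigcupP; exists (Ordinal iq') => //; rewrite inE muln_gt0 /= wa ?wb.
apply: (subdivision_copy q0 b_inj Pr).
- move=> f f' i j iq jq.
  (* By symmetry [f] has the more recent newer end; in a tie its older end is at least as old as
     that of [f']. *)
  wlog : f f' i j iq jq / a (val f).2 < a (val f').2 \/
       a (val f).2 = a (val f').2 /\ a (val f').1 <= a (val f).1 => [H E|].
    have [l|l|l] := ltngtP (a (val f).2) (a (val f').2).
    + by apply: H => //; left.
    + by have [] := H _ _ _ _ jq iq (or_introl l) (esym E).
    have [l'|l'] := leqP (a (val f').1) (a (val f).1).
      by apply: H => //; right.
    by have [] := H _ _ _ _ jq iq (or_intror (conj (esym l) (ltnW l'))) (esym E).
  case=> [l E|[/a_inj l]].
    case: (reachedI _ _ (q - i) _ (spannedP _ _ _ l jq)); first by lia.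
    by rewrite -E wb.
  rewrite leq_eqVlt => /orP[/eqP/a_inj l' E|l' E].
    have ff : f = f' by apply/val_inj; rewrite [LHS]surjective_pairing [RHS]surjective_pairing l l'.
    by rewrite -ff in E *; split=> //; apply: Pu E; lia.
  have [_ _ /negP[]] := old _ _ (aE f).
  have [g _ _] := old _ _ l'.
  (* Distances in [meeting] are measured from the common newer end, hence [q - i] and [q - j]. *)
  have qi : q - i < q by lia.
  have qj : q - j < q by lia.
  apply/bigcupP; exists (b (val f).1, b (val f').1) => /=.
    by rewrite g !b_old ?aE // l aE.
  apply/bigcupP; exists (Ordinal qi, Ordinal qj); first by apply/andP; split=> /=; lia.
  rewrite inE; apply/existsP; exists (P f i); rewrite /= !muln_gt0.
  rewrite !subKn; try lia.
  by rewrite wa // wb // E wa // l wb.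
move=> f i x iq E.
have [l|l] := leqP (a x) (a (val f).2).
  move: l; rewrite leq_eqVlt => /orP[/eqP/a_inj xf|l].
    by move: E; rewrite xf -Pq => /Pu; lia.
  by case: (reachedI _ _ 0 q0 (spannedP _ _ _ l iq)); rewrite E nwalks0 eqxx.
case: (reachedI _ _ (q - i) _ (spannedI _ _ l)); first by lia.
by rewrite -E wb.
Qed.

End Existence.

(** * The quantitative statement for a single graph *)

Section Finite.
Local Open Scope nat_scope.

(** The quotient measures how far [d ^ (k + k)] falls short of the order of [G]. The losses in the
    selection are powers of it; the exponent is doubled because [La] gets multiplied by [mu] or
    [nu], themselves linear in [La]. *)
Lemma subdivision_of_almost_regular (F : sgraph) (k K : nat) : 0 < k -> 0 < K ->
  exists C, forall (G : sgraph) (d : nat), 0 < d -> 0 < #|G| ->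
    (forall x : G, d <= \sum_y adj x y <= K * d) ->
    C * (#|G| %/ d ^ (k + k)).+1 ^ (2 * loss #|F|) <= d ->
  contains_copy (subdivision F (k + k).-1) G.
Proof.
move=> k0 K0; set t := #|F|.
have [q qk] : {q | q = k + k} by exists (k + k).
rewrite -qk; have q1 : 1 < q by lia.
have qq : q + q = (q + q).-1.+1 by rewrite prednK // addn_gt0 ltnW.
pose s := t + #|edge F| * q.
pose Q := 4 ^ t * (1 + 2 * q ^ 2 + 4 * q ^ 2 * s).
pose c1 := (Q * K) ^ q.
have Q0 : 0 < Q by rewrite muln_gt0 expn_gt0.
have c0 : 0 < c1 by rewrite expn_gt0 muln_gt0 Q0 K0.
(* Lower bounds on [d / La ^ 2] that make, respectively, pairs with looping walks rare, [reached]
   small, and pairs violating the meeting bound rare. *)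
pose X1 := 3 * q ^ 2 * K ^ q.-1 * c1.
pose X2 := 2 * (t + 3 * t ^ 2 * q.+1 * c1) * q * K ^ q.-1 * c1.
pose X3 := 3 * (2 * t ^ 2 * q ^ 2).+1 * q ^ 2 * K ^ (q + q).-1 * c1 ^ 2.
exists ((X1 + X2 + X3) * (4 * c1) ^ (2 * loss t)) => G d d0 V0 hdeg hd.
set n := #|G| in V0 hd *; set Z := (n %/ d ^ q).+1 in hd *.
have degd x : d <= \sum_y @adj G x y by case/andP: (hdeg x).
have degD x : \sum_y @adj G x y <= K * d by case/andP: (hdeg x).
have D0 : 0 < K * d by rewrite muln_gt0 K0.
have deg0 x : 0 < \sum_y @adj G x y by apply: leq_trans (degd x).
have sym := @adj_sym G; have irr := @adj_irrefl G.
have dq0 : 0 < d ^ q by rewrite expn_gt0 d0.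
have [[c [sc pc]]|noK] := pselect (exists c : seq G, size c = t /\ pairwise (linked (@adj G) s q) c).
  exact: clique_copy (ltnW q1) (leqnn _) sc pc.
have T : \sum_x \sum_y nwalks (@adj G) q x y ^ 2 <= c1 * (n * d ^ q).
  have -> : \sum_x \sum_y nwalks (@adj G) q x y ^ 2 = num_closed (@adj G) q.
    by apply: eq_bigr => x _; rewrite closed_even.
  have h : num_closed (@adj G) q <= Q * (K * d) * num_closed (@adj G) q.-1.
    apply: (linked_clique sym irr degD deg0 (s := s) q1 (k := k)) => // c sc pc.
    by apply: noK; exists c.
  rewrite -[q in num_closed _ q](prednK (ltnW q1)) in h *.
  apply: leq_trans (num_closed_le sym deg0 V0 h) _.
  rewrite prednK ?(ltnW q1) // mulnA expnMn -/c1 mulnCA; exact: leqnn.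
have nZ : n <= Z * d ^ q.
  by rewrite mulnC /Z {1}(divn_eq n (d ^ q)) mulnC mulnS addnC leq_add2r ltnW // ltn_pmod.
(* There are at least [n * d ^ q] walks of length [q]; Cauchy-Schwarz against the energy bound then
   caps [d ^ q]. *)
have dn : d ^ q <= c1 * n.
  have : (n * d ^ q) ^ 2 <= n ^ 2 * (c1 * (n * d ^ q)).
    apply: (@leq_trans ((\sum_(p : G * G) nwalks (@adj G) q p.1 p.2) ^ 2)).
      rewrite leq_sqr -(pair_bigA _ (fun x y => nwalks (@adj G) q x y)) /=.
      exact: sum_sum_nwalks_ge.
    apply: leq_trans (sum_sqr_le _ _) _; apply: leq_mul.
      by rewrite -mulnn -card_prod; apply: max_card.
    by rewrite -(pair_bigA _ (fun x y => nwalks (@adj G) q x y ^ 2)).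
  have -> : (n * d ^ q) ^ 2 = n ^ 2 * d ^ q * d ^ q by ring.
  have -> : n ^ 2 * (c1 * (n * d ^ q)) = n ^ 2 * d ^ q * (c1 * n) by ring.
  by rewrite leq_pmul2l // muln_gt0 expn_gt0 V0.
pose La := (4 * c1 * Z) ^ loss t.
have La0 : 0 < La by rewrite expn_gt0 !muln_gt0 c0.
have hd' : (X1 + X2 + X3) * La ^ 2 <= d.
  apply: leq_trans hd; rewrite /La -expnM expnMn mulnA.
  by rewrite (mulnC (loss t)).
have hX X : X <= X1 + X2 + X3 -> X * La ^ 2 <= d.
  by move=> le_X; apply: leq_trans hd'; rewrite leq_mul2r le_X orbT.
(* The quantities to be bounded have one factor [d] fewer than [d ^ q] or [d ^ (q + q)]; that spare
   factor absorbs the coefficient [X]. *)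
have lin X : X * c1 <= d -> X * d ^ q.-1 <= n.
  move=> h; rewrite -(leq_pmul2l c0); apply: leq_trans dn.
  rewrite -{2}(prednK (ltnW q1)) expnS mulnCA mulnA.
  by rewrite leq_mul2r h orbT.
have quad X : X * c1 ^ 2 <= d -> X * d ^ (q + q).-1 <= n ^ 2.
  move=> h; have c20 : 0 < c1 ^ 2 by rewrite expn_gt0 c0.
  rewrite -(leq_pmul2l c20); apply: (@leq_trans (d ^ (q + q))).
    by rewrite {2}qq (expnS d) mulnCA mulnA leq_mul2r h orbT.
  by rewrite addnn -muln2 expnM -expnMn leq_sqr.
pose mu := 3 * La * c1; pose nu := (2 * La * (t ^ 2 * q ^ 2)).+1.
have La12 : La <= La ^ 2 by rewrite -{1}[La]expn1 leq_pexp2l.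
have [vs so sp] : exists2 o : seq G, size o = t & spread (@adj G) (K * d) q mu nu o.
  apply: (exists_spread (d := d) (k := k) (c1 := c1) (Z := Z)) => //.
    rewrite -/La; apply: (num_crowded_le sym degD D0 V0 (c1 := c1)) => //.
    - apply: leq_trans T _; rewrite -mulnn -!mulnA leq_mul2l; apply/orP; right.
      by rewrite -mulnn mulnCA leq_mul2l dn orbT.
    - have -> : 3 * La * (q ^ 2 * (K * d) ^ q.-1) = 3 * La * q ^ 2 * K ^ q.-1 * d ^ q.-1.
        by rewrite expnMn; ring.
      apply: lin; apply: leq_trans (hX X1 _); last by rewrite -addnA leq_addr.
      have -> : 3 * La * q ^ 2 * K ^ q.-1 * c1 = X1 * La by rewrite /X1; ring.
      by rewrite leq_mul2l La12 orbT.
    have -> : 3 * La * (q ^ 2 * (nu * (K * d) ^ (q + q).-1)) =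
        3 * La * q ^ 2 * nu * K ^ (q + q).-1 * d ^ (q + q).-1.
      by rewrite expnMn; ring.
    apply: quad; apply: leq_trans (hX X3 _); last by rewrite leq_addl.
    have -> : X3 * La ^ 2 = 3 * La * q ^ 2 * (La * (2 * t ^ 2 * q ^ 2).+1) * K ^ (q + q).-1 * c1 ^ 2.
      by rewrite /X3; ring.
    rewrite !leq_mul2r; apply/orP; right; apply/orP; right.
    rewrite leq_mul2l; apply/orP; right; rewrite /nu mulnS -add1n leq_add //.
    by rewrite leq_eqVlt; apply/orP; left; apply/eqP; ring.
  rewrite -/La.
  have -> : 2 * La * ((t + t ^ 2 * (q.+1 * mu)) * (q * (K * d) ^ q.-1)) =
      2 * La * (t + t ^ 2 * (q.+1 * mu)) * q * K ^ q.-1 * d ^ q.-1.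
    by rewrite expnMn; ring.
  apply: lin; apply: leq_trans (hX X2 _); last by rewrite addnAC leq_addl.
  have -> : X2 * La ^ 2 = 2 * La * (t * La + t ^ 2 * (q.+1 * mu)) * q * K ^ q.-1 * c1.
    by rewrite /X2 /mu; ring.
  rewrite !leq_mul2r; do 3 (apply/orP; right); rewrite leq_mul2l; apply/orP; right.
  by rewrite leq_add2r leq_pmulr.
exact: spread_copy q1 so sp.
Qed.

(** Taking roots, [n] is at most [d] to the power [q + 1 / (2a)], so [Z ^ a] is at most [2 ^ a]
    times the square root of [d]; the other square root pays for [C]. *)
Lemma large_degree_bound (q C a : nat) : 0 < q -> 0 < a ->
  let A := 2 * q * a in
  forall n d, 0 < d -> C ^ 2 * 4 ^ a <= d -> n ^ A <= d ^ (q * A.+1) ->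
  C * (n %/ d ^ q).+1 ^ a <= d.
Proof.
move=> q0 a0 A n d d0 hd hn; have dq0 : 0 < d ^ q by rewrite expn_gt0 d0.
set Z := _.+1.
suff hZ : Z ^ (2 * a) <= 4 ^ a * d.
  rewrite -leq_sqr expnMn -expnM (mulnC a); apply: leq_trans (leq_mul (leqnn _) hZ) _.
  by rewrite mulnA -mulnn leq_mul2r hd orbT.
have [nd|dn] := ltnP n (d ^ q).
  by rewrite /Z divn_small // exp1n muln_gt0 expn_gt0.
have Zn : Z * d ^ q <= 2 * n.
  have : 0 < n %/ d ^ q by rewrite divn_gt0.
  have := leq_divM n (d ^ q); rewrite /Z mulSn; move: (n %/ _) => z h z0.
  have : d ^ q <= z * d ^ q by rewrite leq_pmull.
  lia.
rewrite -(leq_exp2r _ _ q0) -expnM expnMn.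
have -> : 2 * a * q = A by rewrite /A; ring.
have -> : (4 ^ a) ^ q = 2 ^ A by rewrite -expnM -[4]/(2 ^ 2) -expnM /A; congr (_ ^ _); ring.
have dA0 : 0 < (d ^ q) ^ A by rewrite expn_gt0 dq0.
rewrite -(leq_pmul2r dA0) -expnMn.
apply: (@leq_trans ((2 * n) ^ A)); first by rewrite leq_exp2r // !muln_gt0 q0.
rewrite expnMn -mulnA leq_mul2l; apply/orP; right.
by apply: leq_trans hn _; rewrite expnM expnS.
Qed.

Lemma min_deg_le (G : sgraph) (x : G) : min_deg G <= deg x.
Proof.
rewrite /min_deg; have := mem_index_enum x.
elim: (index_enum _) => //= y r IH; rewrite inE big_cons geq_min.
by case/orP=> [/eqP->|/IH->]; rewrite ?leqnn ?orbT.
Qed.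

Lemma degE (G : sgraph) (x : G) : deg x = \sum_y adj x y.
Proof.
rewrite /deg -sum1_card big_mkcond /=.
by apply: eq_bigr => y _; rewrite inE; case: adj.
Qed.

End Finite.

(** * Passage to the asymptotic statement *)

Local Open Scope classical_set_scope.
Local Open Scope ring_scope.

Theorem theorem2p3 (R : realType) (F : sgraph) (k : nat) (hk : (1 <= k)%N) :
  exists eps : R, 0 < eps /\
    forall (K : R) (hK : 1 <= K) (delta : nat -> nat)
      (hdelta : (fun n : nat => (delta n)%:R / n%:R `^ ((2 * k)%:R^-1 - eps) : R)
                  @ \oo --> +oo),
      \forall n \near \oo,
        forall G : sgraph,
          #|G| = n -> almost_regular K G -> min_deg G = delta n ->
          contains_copy (subdivision F (2 * k - 1)) G.
Proof.
(* The successor keeps [a] positive when [F] has no vertices. *)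
pose q := (k + k)%N; pose a := (2 * loss #|F|).+1.
pose A := (2 * q * a)%N.
have q0 : (0 < q)%N by rewrite /q; lia.
have A0 : (0 < A)%N by rewrite /A /a !muln_gt0 q0.
have qA0 : (0 < q * A.+1)%N by rewrite muln_gt0 q0.
(* Then [1 / q - eps = A / (q * A.+1)], and clearing denominators turns the degree condition into
   the hypothesis [n ^ A <= d ^ (q * A.+1)] of [large_degree_bound]. *)
exists (q * A.+1)%:R^-1; split; first by rewrite invr_gt0 ltr0n.
move=> K hK delta hdelta.
have expE : (2 * k)%:R^-1 - (q * A.+1)%:R^-1 = A%:R / (q * A.+1)%:R :> R.
  have -> : (2 * k = q)%N by rewrite /q; lia.
  have qn0 : q%:R != 0 :> R by rewrite pnatr_eq0 -lt0n.
  have An0 : A.+1%:R != 0 :> R by rewrite pnatr_eq0.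
  rewrite natrM -[A.+1]addn1 natrD in An0 *.
  clearbody A; field.
  by rewrite qn0 andbT.
have [Kn hKn] : exists Kn : nat, K <= Kn%:R.
  by exists (Num.bound K); apply/ltW/archi_boundP/(le_trans _ hK).
have Kn0 : (0 < Kn)%N by rewrite -(ltr_nat R) (lt_le_trans _ hKn) // (lt_le_trans _ hK).
have [C HC] := subdivision_of_almost_regular F hk Kn0.
pose d0 := (C ^ 2 * 4 ^ a).+1.
near=> n => G Gn reg mindeg.
have n0 : (0 < n)%N by near: n; exists 1%N.
have npos : 0 < n%:R :> R by rewrite ltr0n.
have hn : (n ^ A <= delta n ^ (q * A.+1))%N.
  have : 1 <= (delta n)%:R / n%:R `^ ((2 * k)%:R^-1 - (q * A.+1)%:R^-1) :> R.
    near: n; move/cvgryPge: hdelta; exact.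
  rewrite expE ler_pdivlMr ?powR_gt0 // mul1r => h.
  rewrite -(ler_nat R) !natrX.
  have -> : n%:R ^+ A = (n%:R `^ (A%:R / (q * A.+1)%:R)) ^+ (q * A.+1) :> R.
    rewrite -[RHS]powR_mulrn ?powR_ge0 // -powRrM mulfVK ?pnatr_eq0 -?lt0n //.
    by rewrite powR_mulrn // ltW.
  by apply: lerXn2r => //; rewrite nnegrE ?powR_ge0 ?ler0n.
(* A degree below the constant [d0] would bound [n], since [n <= n ^ A <= delta n ^ (q * A.+1)]. *)
have dl : (d0 <= delta n)%N.
  rewrite leqNgt; apply/negP => lt_d.
  have big_n : (d0 ^ (q * A.+1) < n)%N by near: n; exists (d0 ^ (q * A.+1)).+1.
  suff : (n < n)%N by rewrite ltnn.
  apply: leq_ltn_trans big_n; apply: leq_trans (_ : n ^ A <= _)%N.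
    by rewrite -{1}[n]expn1 leq_pexp2l.
  by apply: leq_trans hn _; rewrite leq_exp2r // ltnW.
have degb (x : G) : (delta n <= \sum_y adj x y <= Kn * delta n)%N.
  rewrite -degE -mindeg min_deg_le /= -(ler_nat R) natrM.
  apply: (@le_trans _ _ (max_deg G)%:R).
    by rewrite ler_nat; apply: leq_bigmax.
  by apply: le_trans reg _; rewrite ler_wpM2r.
have -> : (2 * k - 1 = (k + k).-1)%N by lia.
apply: (HC G (delta n)) => //.
- by apply: leq_trans dl.
- by rewrite Gn.
rewrite Gn; apply: leq_trans (large_degree_bound (a := a) q0 isT (leq_trans _ dl) (ltnW dl) hn).
  by rewrite leq_mul2l leq_pexp2l ?orbT.
Unshelve. all: by end_near.
Qed.
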